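(* Let $s,n\in\mathbb{N}$ be powers of $3$ with $n\ge9s$, $\sigma>0$, $\delta\in(0,1)$. Observations are $y_t=x_t+\sigma\xi_t$, $|t|\le 2n$, with $\xi_t$ i.i.d. standard complex Gaussian $\mathbb{C}\mathcal{N}(0,1)$. Consider testing $\mathscr{H}_{0,n}=\{x\in\mathbb{C}(\mathbb{Z}):\|x\|_{2n,2}=0\}$ against $\mathscr{H}_{s,n}(\mathsf{r})=\{x\in\mathscr{X}_s:\|x\|_{2n,2}\ge\mathsf{r}\}$, where $$\mathsf{r}^2\ge\mathsf{r}_0^2:=128\mathsf{c}_\star^2\sigma^2\Big(6s+3s\log(2n+1)+\log(9e^3s)\log\big(6\log_3(n/s)\,\delta^{-1}\big)\Big)\log(9e^4s)\log_3(n/s),\quad\mathsf{c}_\star=2.16\pi^2+6.$$ Let $\widehat T_n(y)=\|y\|_{2n,2}^2-\|y-\widehat x^{\mathsf{full}}\|_{2n,2}^2$. The test that rejects $\mathscr{H}_{0,n}$ when $\widehat T_n(y)>\tfrac58\mathsf{r}_0^2$ satisfies: for every $x\in\mathscr{H}_{0,n}$ it rejects with probability at most $\delta$, and for every $x\in\mathscr{H}_{s,n}(\mathsf{r})$ it fails to reject with probability at most $\delta$.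
   Context: $\mathbb{C}(\mathbb{Z})$: two-sided complex sequences; $\mathbb{C}_p(\mathbb{Z})$: those with $x_t=0$ for $|t|>p$. $(\Delta x)_t=x_{t-1}$. $\mathscr{X}_s$ is the union over $(w_1,\dots,w_s)\in\mathbb{C}^s$ of $\{x:\mathsf{f}(\Delta)x=0\}$ with $\mathsf{f}(z)=\prod_k(1-w_kz)$. Convolution $(u*v)_t=\sum_\tau u_\tau v_{t-\tau}$; $\|u\|_{p,2}=(\sum_{|t|\le p}|u_t|^2)^{1/2}$; DFT $(\mathcal{F}_p[u])_k=(2p+1)^{-1/2}\sum_{|\tau|\le p}\exp(-i2\pi k\tau/(2p+1))u_\tau$, $k=0,\dots,2p$. The estimate $\widehat x^{\mathsf{full}}$: let $\widehat\varphi^{(0)}\in\mathbb{C}_n(\mathbb{Z})$ minimize $\|\varphi*y-y\|_{n,2}$ subject to $\max\{\|\mathcal{F}_n[\varphi]\|_1,18s\|\mathcal{F}_n[\varphi]\|_\infty\}\le18\mathsf{c}_\star s/\sqrt{2n+1}$, and $\widehat x^{\mathsf{full}}_t=(\widehat\varphi^{(0)}*y)_t$ for $|t|\le n$. With $K=\log_3(n/(9s))$, $n_k=n3^{-k}$, $h_k=2n-2n_k$, $I^{(k,+)}=(h_k-n_k,h_k+n_k]$, $I^{(k,-)}=[-h_k-n_k,-h_k+n_k)$ ($k=1,\dots,K$), let $\widehat\varphi^{(k,\pm)}\in\mathbb{C}_{n_k}(\mathbb{Z})$ minimize $\|\Delta^{\mp h_k}[\varphi*y-y]\|_{n_k,2}$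 (where $(\Delta^{-h}u)_t=u_{t+h}$) subject to $\max\{\|\mathcal{F}_{n_k}[\varphi]\|_1,18s\|\mathcal{F}_{n_k}[\varphi]\|_\infty\}\le18\mathsf{c}_\star s/\sqrt{2n_k+1}$, and $\widehat x^{\mathsf{full}}_t=(\widehat\varphi^{(k,\pm)}*y)_t$ for integer $t\in I^{(k,\pm)}$; finally $\widehat x^{\mathsf{full}}_t=y_t$ for $2n-9s<|t|\le2n$. *)

(* Defs.v *)
From HB Require Import structures.
From mathcomp Require Import all_boot all_order all_algebra.
From mathcomp Require Import all_classical all_reals all_analysis.
From mathcomp Require Import complex.

Set Implicit Arguments.
Unset Strict Implicit.
Unset Printing Implicit Defensive.

Import Order.TTheory GRing.Theory Num.Theory.
Local Open Scope classical_set_scope.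
Local Open Scope ring_scope.

Section Defs.
Variable R : realType.
Local Notation C := R[i].

Definition cseq := int -> C.

Definition symsum (V : nmodType) (p : nat) (F : int -> V) : V :=
  \sum_(i < (2 * p).+1) F (i%:Z - p%:Z).

Definition norm2 (p : nat) (u : cseq) : R :=
  Num.sqrt (symsum p (fun t => Normc.normc (u t) ^+ 2)).

Definition supported (p : nat) (u : cseq) : Prop :=
  forall t : int, (p%:Z < `|t|)%R -> u t = 0.

(* convolution (phi * y)_t = sum_tau phi_tau y_(t - tau), for phi in C_p(Z)
   (the terms with |tau| > p vanish) *)
Definition conv (p : nat) (phi y : cseq) : cseq :=
  fun t => symsum p (fun tau => phi tau * y (t - tau)).

Definition Delta (x : cseq) : cseq := fun t => x (t - 1).

Definition Delta_inv (h : int) (u : cseq) : cseq := fun t => u (t + h).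

Definition poly_Delta (f : {poly C}) (x : cseq) : cseq :=
  fun t => \sum_(i < size f) f`_i * iter i Delta x t.

Definition Xs (s : nat) : set cseq :=
  [set x | exists w : 'I_s -> C,
     poly_Delta (\prod_(k < s) (1 - (w k)%:P * 'X)) x = (fun _ => 0)].

Definition expi (theta : R) : C := Complex (cos theta) (sin theta).

Definition dft (p : nat) (u : cseq) (k : nat) : C :=
  Complex ((Num.sqrt ((2 * p).+1)%:R)^-1) 0 *
  symsum p (fun tau => expi (- (2 * pi * k%:R * tau%:~R / ((2 * p).+1)%:R)) * u tau).

Definition dft_l1 (p : nat) (u : cseq) : R :=
  \sum_(k < (2 * p).+1) Normc.normc (dft p u k).

Definition dft_linf (p : nat) (u : cseq) : R :=
  \big[Num.max/0]_(k < (2 * p).+1) Normc.normc (dft p u k).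

Definition c_star : R := (216%:R / 100%:R) * pi ^+ 2 + 6%:R.

Definition feasible (s p : nat) (phi : cseq) : Prop :=
  supported p phi /\
  Num.max (dft_l1 p phi) (18%:R * s%:R * dft_linf p phi)
    <= 18%:R * c_star * s%:R / Num.sqrt ((2 * p).+1)%:R.

Definition fit_loss (p : nat) (h : int) (y phi : cseq) : R :=
  norm2 p (Delta_inv h (fun t => conv p phi y t - y t)).

Definition is_minimizer (s p : nat) (h : int) (y phi : cseq) : Prop :=
  feasible s p phi /\
  forall psi, feasible s p psi -> fit_loss p h y phi <= fit_loss p h y psi.

Definition Kof (n s : nat) : nat := trunc_log 3 (n %/ (9 * s)).

(* xh is (one admissible version of) the estimate \hat x^full computed from y
   (on the window |t| <= 2n) *)
Definition is_xfull (s n : nat) (y xh : cseq) : Prop :=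
  (exists phi, is_minimizer s n 0 y phi /\
     forall t : int, (`|t| <= n%:Z)%R -> xh t = conv n phi y t) /\
  (forall k : nat, (1 <= k <= Kof n s)%N ->
     let nk := (n %/ 3 ^ k)%N in
     let hk : int := (2 * n)%:Z - (2 * nk)%:Z in
     (exists phi, is_minimizer s nk hk y phi /\
        forall t : int, (hk - nk%:Z < t)%R -> (t <= hk + nk%:Z)%R ->
          xh t = conv nk phi y t) /\
     (exists phi, is_minimizer s nk (- hk) y phi /\
        forall t : int, (- hk - nk%:Z <= t)%R -> (t < - hk + nk%:Z)%R ->
          xh t = conv nk phi y t)) /\
  (forall t : int, ((2 * n)%:Z - (9 * s)%:Z < `|t|)%R -> (`|t| <= (2 * n)%:Z)%R ->
     xh t = y t).

Definition Tstat (n : nat) (y xh : cseq) : R :=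
  norm2 (2 * n) y ^+ 2 - norm2 (2 * n) (fun t => y t - xh t) ^+ 2.

Definition log3 (x : R) : R := ln x / ln 3%:R.

Definition r0sq (s n : nat) (sigma delta : R) : R :=
  128%:R * c_star ^+ 2 * sigma ^+ 2 *
  (6%:R * s%:R + 3%:R * s%:R * ln ((2 * n).+1)%:R
   + ln (9%:R * expR 3%:R * s%:R) *
     ln (6%:R * log3 (n%:R / s%:R) / delta)) *
  ln (9%:R * expR 4%:R * s%:R) * log3 (n%:R / s%:R).

End Defs.

(* xi_t, |t| <= N, are i.i.d. standard complex Gaussian CN(0,1) on the
   probability space (T, P): real and imaginary parts are measurable, and the
   2(2N+1) real variables (Re xi_t, Im xi_t) are mutually independent with law
   N(0, 1/2) each (product rule for all Borel rectangles). *)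
Definition iid_std_cgauss (R : realType) (d : measure_display)
  (T : measurableType d) (P : probability T R) (xi : int -> T -> R[i]) (N : nat)
  : Prop :=
  (forall t : int, (`|t| <= N%:Z)%R ->
     measurable_fun setT (fun w => complex.Re (xi t w)) /\
     measurable_fun setT (fun w => complex.Im (xi t w))) /\
  (forall B D : int -> set R,
     (forall t : int, measurable (B t) /\ measurable (D t)) ->
     P (\bigcap_(t in [set t : int | (`|t| <= N%:Z)%R])
          [set w | B t (complex.Re (xi t w)) /\ D t (complex.Im (xi t w))])
     = (\prod_(i < (2 * N).+1)
          (normal_prob 0 (Num.sqrt (2%:R^-1)) (B (i%:Z - N%:Z)%R) *
           normal_prob 0 (Num.sqrt (2%:R^-1)) (D (i%:Z - N%:Z)%R)))%E).

(* Main.v *)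
(* Averaging over the window the orthogonal projector onto the length-(p+1)
   windows of a shift-invariant space of dimension at most s gives a filter
   supported on [-p, p] that reproduces the space and whose frequency response
   at theta is <e_theta, Pi e_theta> / (p + 1).  This lies in [0, 1], and its sum
   over the 2p+1 Fourier frequencies is at most 2s, so the filter is feasible.

   For any feasible filter phi, expanding phi * xi on a circle of twice the
   length turns <xi, phi * xi> into a sum over frequencies of squared Fourier
   coefficients of the noise, weighted by the response of phi.  The response at
   odd frequencies is interpolated from the even ones through the Dirichlet
   kernel, whose l^1 norm over any 18s frequencies is O(log s).  As the even
   response is at most c_star and sums to at most 18 s c_star, the sum is at most
   c_star times its value at the indicator of some set of 18s frequencies.  For
   each fixed set this is a positive quadratic form of the noise, controlled by
   its exponential moment, and a union bound over the sets gives s log n.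

   If x vanishes, the statistic is at most a sum of such cross terms over the
   blocks, plus the noise energy on the edges.  If x does not vanish, comparing
   each block's minimizer with the averaged projector, which reproduces x exactly,
   bounds the residual by the energy of xi plus the same quadratic forms. *)
Require Import Defs.
From HB Require Import structures.
From mathcomp Require Import all_boot all_order all_algebra.
From mathcomp Require Import all_classical all_reals all_analysis.
From mathcomp Require Import complex.
From mathcomp Require Import measurable_realfun spectral.
From mathcomp Require Import ring lra zify.

Set Implicit Arguments.
Unset Strict Implicit.
Unset Printing Implicit Defensive.

Import Order.TTheory GRing.Theory Num.Theory.
Import numFieldNormedType.Exports.
Local Open Scope classical_set_scope.
Local Open Scope ring_scope.

(** * Layer-cake transfer of integrals between two measure spaces *)

Section layer_cake.
Context d (T : measurableType d) (R : realType).
Notation leb := (@lebesgue_measure R).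

(** The minimizers depend on the noise, and [est] is an arbitrary selection of them, so no filter
    can be treated as independent of [xi] or even as measurable. Probability is therefore spent on
    events that concern the noise alone and serve every feasible filter at once, and each error
    event is enclosed in a measurable exceptional set. Such uniformity is affordable because the
    bounds are linear in the modulus of the response, which leaves finitely many extreme points to
    control. A filter of radius m acts on noise of radius 2m, so convolution becomes multiplication
    without wrap-around on any circle of at least 4m+1 points. Length 2(2m+1) is long enough and
    keeps the 2m+1 constrained frequencies as its even ones. Here log_3(n/s) is K+2, and at most
    6(K+2) exceptional events arise, each allotted probability delta / (6 (K+2)). The threshold 5/8
    is 1 - 1/8 - 1/4: the linear term in the noise may consume an eighth of the signal energy, and
    all other losses stay below a quarter of r0^2. *)

Lemma integral_layer (c : R) : 0 <= c ->
  (\int[leb]_u (\1_`[0, c[%classic u)%:E = c%:E)%E.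
Proof.
move=> c0; rewrite integral_indic// setIT -[LHS]/(lebesgue_measure [set` `[0, c[%R]).
rewrite (lebesgue_measure_itv `[0, c[%R)/= lte_fin.
by case: ltgtP c0 => // [_ _|<- _]; rewrite ?sube0.
Qed.

Lemma measurable_layer (f : T -> R) : measurable_fun setT f ->
  measurable_fun setT (fun z : T * R => \1_`[0, f z.1[%classic z.2 : R).
Proof.
move=> mf.
rewrite (_ : (fun _ => _) = \1_[set z : T * R | (0 <= z.2) && (z.2 < f z.1)]).
  apply: measurable_indic.
  suff : measurable_fun setT (fun z : T * R => (0 <= z.2) && (z.2 < f z.1)).
    move=> /(_ measurableT [set true] I); rewrite setTI.
    by congr (measurable _); apply/seteqP; split => z.
  apply: measurable_and; first exact: measurable_fun_ler.
  by apply: measurable_fun_ltr => //; exact: measurableT_comp.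
apply/funext => z; rewrite !indicE; congr (_%:R).
Qed.
End layer_cake.

(* Layer cake: both sides are integrals over u of the hypothesis applied to
   the superlevel set of h at height u. *)
Lemma integral_transfer d1 d2 (T1 : measurableType d1) (T2 : measurableType d2)
  (R : realType) (m1 : {sigma_finite_measure set T1 -> \bar R})
  (m2 : {sigma_finite_measure set T2 -> \bar R})
  (X : T1 -> T2) (G : T1 -> R) (w : T2 -> R) (h : T2 -> R) :
  measurable_fun setT X -> measurable_fun setT G -> measurable_fun setT w ->
  measurable_fun setT h ->
  (forall x, 0 <= G x) -> (forall y, 0 <= w y) -> (forall y, 0 <= h y) ->
  (forall B, measurable B ->
    (\int[m1]_x (\1_B (X x) * G x)%:E = \int[m2]_y (\1_B y * w y)%:E)%E) ->
  (\int[m1]_x (h (X x) * G x)%:E = \int[m2]_y (h y * w y)%:E)%E.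
Proof.
move=> mX mG mw mh G0 w0 h0 H.
have key d0 (T0 : measurableType d0) (m0 : {sigma_finite_measure set T0 -> \bar R})
    (f : T0 -> R) (g : T0 -> R) :
    measurable_fun setT f -> measurable_fun setT g -> (forall x, 0 <= f x) ->
    (forall x, 0 <= g x) ->
    (\int[m0]_x (f x * g x)%:E =
     \int[lebesgue_measure]_u \int[m0]_x (\1_`[0, f x[%classic u * g x)%:E)%E.
  move=> mf mg f0 g0.
  transitivity (\int[m0]_x \int[@lebesgue_measure R]_u (\1_`[0, f x[%classic u * g x)%:E)%E.
    apply: eq_integral => x _.
    under [RHS]eq_integral do rewrite EFinM muleC.
    rewrite ge0_integralZl_EFin//; last first.
      by apply/measurable_EFinP; exact: measurable_indic.
    by rewrite integral_layer// -EFinM mulrC.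
  pose F := fun z : T0 * R => (\1_`[0, f z.1[%classic z.2 * g z.1)%:E.
  rewrite -[LHS]/(\int[m0]_x \int[@lebesgue_measure R]_u F (x, u))%E.
  rewrite (@fubini_tonelli _ _ _ _ _ m0 (@lebesgue_measure R) F)//.
  - apply/measurable_EFinP; apply: measurable_funM; first exact: measurable_layer.
    exact: measurableT_comp.
  - by move=> z; rewrite lee_fin mulr_ge0.
rewrite (key _ _ m1 (h \o X) G)//; [|exact: measurableT_comp|by move=> x; exact: h0].
rewrite (key _ _ m2 h w)//.
apply: eq_integral => u _.
have mB : measurable [set y | (0 <= u) && (u < h y)].
  have [u0|u0] := boolP (0 <= u).
    rewrite (_ : [set _ | _] = h @^-1` `]u, +oo[).
      by rewrite -[X in measurable X]setTI; apply: mh.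
    by apply/seteqP; split => y /=; rewrite in_itv/= andbT.
  by rewrite (_ : [set _ | _] = set0)//; apply/seteqP; split.
have HH := H _ mB.
have E c : \1_`[0, c[%classic u = \1_[set y : R | (0 <= u) && (u < y)] c :> R.
  by rewrite !indicE; congr (_%:R); apply/idP/idP; rewrite !inE/= in_itv.
have E2 (y : T2) : \1_[set y | (0 <= u) && (u < h y)] y = \1_[set y : R | (0 <= u) && (u < y)] (h y) :> R.
  by rewrite !indicE; congr (_%:R); apply/idP/idP; rewrite !inE.
transitivity (\int[m1]_x (\1_[set y | (0 <= u) && (u < h y)] (X x) * G x)%:E)%E.
  by apply: eq_integral => x _; rewrite E E2.
by rewrite HH; apply: eq_integral => x _; rewrite E E2.
Qed.

(** * Laplace transforms of the law N(0, 1/2) *)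

Section half_gaussian.
Context {R : realType}.
Notation leb := (@lebesgue_measure R).

(* The density of N(0, 1/2), the law of Re and Im of a CN(0,1) variable. *)
Definition half_pdf : R -> R := normal_pdf 0 (Num.sqrt (2%:R^-1)).

Lemma integral_gauss_shift (a b : R) : 0 < a ->
  (\int[leb]_x (expR (- a * (x - b) ^+ 2))%:E = (Num.sqrt (pi / a))%:E)%E.
Proof.
move=> a0; pose s := Num.sqrt ((2 * a)^-1).
have s2 : s ^+ 2 *+ 2 = a^-1.
  rewrite sqr_sqrtr ?invr_ge0 ?mulr_ge0 ?ltW//.
  by rewrite invfM -mulr_natl mulrA mulfV ?mul1r.
have s0 : s != 0 by rewrite gt_eqF// sqrtr_gt0 invr_gt0 mulr_gt0.
have pk : normal_peak s = (Num.sqrt (pi / a))^-1.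
  by rewrite /normal_peak -mulrnAl s2 mulrC.
have pk0 := normal_peak_gt0 s0.
have := integral_normal_pdf b s; rewrite normal_pdfE//.
under eq_integral do rewrite EFinM.
rewrite ge0_integralZl_EFin//; [|by move=> x _; rewrite lee_fin normal_fun_ge0| |exact: ltW].
  move=> H.
  have -> : (\int[leb]_x (expR (- a * (x - b) ^+ 2))%:E =
             \int[leb]_x (normal_fun b s x)%:E)%E.
    by apply: eq_integral => x _; rewrite /normal_fun s2 invrK mulNr mulNr (mulrC a).
  (* Finiteness is not known beforehand; an infinite value would contradict the total mass 1 of the
     normal density. *)
  move: H; case: (\int[leb]_x _)%E => [r| |].
  - rewrite -EFinM pk => -[] /(congr1 (fun z => Num.sqrt (pi / a) * z)).
    rewrite mulVKf ?mulr1; first by move=> ->.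
    by rewrite -invr_eq0 -pk gt_eqF.
  - by rewrite gt0_muley ?lte_fin.
  - by rewrite gt0_muleNy ?lte_fin.
by apply/measurable_EFinP; exact: measurable_normal_fun.
Qed.

Lemma half_pdfE x : half_pdf x = (Num.sqrt pi)^-1 * expR (- x ^+ 2).
Proof.
have h : (Num.sqrt (2%:R^-1 : R)) ^+ 2 *+ 2 = 1.
  by rewrite sqr_sqrtr// -mulr_natl mulfV.
rewrite /half_pdf normal_pdfE; last by rewrite gt_eqF// sqrtr_gt0 invr_gt0.
by rewrite /normal_peak /normal_fun -mulrnAl h mul1r subr0 invr1 mulr1.
Qed.

Lemma half_pdf_ge0 x : 0 <= half_pdf x. Proof. exact: normal_pdf_ge0. Qed.

Lemma measurable_half_pdf : measurable_fun setT half_pdf.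
Proof. exact: measurable_normal_pdf. Qed.

Lemma half_pdf_mgf (b : R) :
  (\int[leb]_x (expR (b * x) * half_pdf x)%:E = (expR (b ^+ 2 / 4))%:E)%E.
Proof.
have pi0 : 0 < Num.sqrt pi :> R by rewrite sqrtr_gt0 pi_gt0.
transitivity (\int[leb]_x ((expR (b ^+ 2 / 4) / Num.sqrt pi)%:E *
   (expR (- 1 * (x - b / 2) ^+ 2))%:E))%E.
  apply: eq_integral => x _; rewrite half_pdfE -EFinM; congr EFin.
  rewrite mulrCA -expRD mulrAC -expRD mulrC; congr (expR _ * _).
  by field.
rewrite ge0_integralZl_EFin//; first last.
- apply/measurable_EFinP; apply: measurableT_comp => //.
  apply: measurable_funM => //; apply: measurable_funX.
  exact: measurable_funB.
by rewrite integral_gauss_shift// divr1 -EFinM divfK// gt_eqF.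
Qed.

Lemma half_pdf_sq (l : R) : l < 1 ->
  (\int[leb]_x (expR (l * x ^+ 2) * half_pdf x)%:E = ((Num.sqrt (1 - l))^-1)%:E)%E.
Proof.
move=> l1; have pi0 : 0 < Num.sqrt pi :> R by rewrite sqrtr_gt0 pi_gt0.
transitivity (\int[leb]_x ((Num.sqrt pi)^-1%:E *
   (expR (- (1 - l) * (x - 0) ^+ 2))%:E))%E.
  apply: eq_integral => x _; rewrite half_pdfE -EFinM; congr EFin.
  rewrite mulrCA -expRD; congr (_ * expR _).
  by ring.
rewrite ge0_integralZl_EFin//; first last.
- apply/measurable_EFinP; apply: measurableT_comp => //.
  apply: measurable_funM => //; apply: measurable_funX.
  exact: measurable_funB.
rewrite integral_gauss_shift ?subr_gt0// -EFinM sqrtrM ?pi_ge0//.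
by rewrite mulKf ?gt_eqF// sqrtrV// subr_ge0 ltW.
Qed.

End half_gaussian.

(** * Linearizing a square by an auxiliary Gaussian variable *)

Section gauss_linearization.
Context d (T : measurableType d) (R : realType) (P : probability T R).

(* expR (X ^+ 2) is the average of expR (2 * g * X) over g of law N(0, 1/2), and
   integrating expR (l * g ^+ 2) against that law costs (1 - l)^(-1/2) <= expR l. *)
Lemma gauss_linearize (X Y : T -> R) (q l : R) :
  measurable_fun setT X -> measurable_fun setT Y -> 0 <= l <= 2^-1 ->
  (forall g, (\int[P]_w (expR (Y w + 2 * g * X w))%:E <= (expR (q + l * g ^+ 2))%:E)%E) ->
  (\int[P]_w (expR (Y w + X w ^+ 2))%:E <= (expR (q + l))%:E)%E.
Proof.
move=> mX mY /andP[l0 l1] H.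
pose F := fun z : T * R => (expR (Y z.1 + 2 * z.2 * X z.1) * half_pdf z.2)%:E.
have mF : measurable_fun setT F.
  apply/measurable_EFinP; apply: measurable_funM.
    apply: measurableT_comp => //; apply: measurable_funD.
      exact: measurableT_comp.
    apply: measurable_funM; first by apply: measurable_funM.
    exact: measurableT_comp.
  by apply: measurableT_comp => //; exact: measurable_half_pdf.
have F0 z : (0 <= F z)%E by rewrite lee_fin mulr_ge0 ?expR_ge0 ?half_pdf_ge0.
have -> : (\int[P]_w (expR (Y w + X w ^+ 2))%:E =
           \int[P]_w \int[@lebesgue_measure R]_g F (w, g))%E.
  apply: eq_integral => w _; rewrite /F/=.
  transitivity (\int[lebesgue_measure]_g ((expR (Y w))%:E * (expR (2 * X w * g) * half_pdf g)%:E))%E.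
    rewrite ge0_integralZl_EFin ?expR_ge0//; first last.
    - apply/measurable_EFinP; apply: measurable_funM; last exact: measurable_half_pdf.
      by apply: measurableT_comp => //; exact: measurable_funM.
    - by move=> g _; rewrite lee_fin mulr_ge0 ?expR_ge0 ?half_pdf_ge0.
    by rewrite half_pdf_mgf -EFinM -expRD; congr (expR _)%:E; field.
  apply: eq_integral => g _; rewrite -EFinM mulrA -expRD.
  by congr (expR (_ + _) * _)%:E; ring.
rewrite (@fubini_tonelli _ _ _ _ _ P (@lebesgue_measure R) F)//.
apply: (@le_trans _ _ (\int[@lebesgue_measure R]_g ((expR q)%:E * (expR (l * g ^+ 2) * half_pdf g)%:E))%E).
  apply: ge0_le_integral => //.
  - by move=> g _; apply: integral_ge0.
  - exact: (measurable_fun_fubini_tonelli_G F).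
  - apply/measurable_EFinP; apply: measurable_funM => //.
    apply: measurable_funM; last exact: measurable_half_pdf.
    apply: measurableT_comp => //; apply: measurable_funM => //.
  - move=> g _; rewrite /F/=.
    under eq_integral do rewrite EFinM.
    rewrite ge0_integralZr ?lee_fin ?half_pdf_ge0//; first last.
    + apply/measurable_EFinP; apply: measurableT_comp => //; apply: measurable_funD => //.
      exact: measurable_funM.
    rewrite -EFinM mulrA -expRD EFinM lee_pmul ?lee_fin ?half_pdf_ge0//.
    by apply: integral_ge0 => w _; rewrite lee_fin expR_ge0.
have l11 : l < 1 by apply: le_lt_trans l1 _; rewrite invf_lt1 ?ltr1n.
rewrite ge0_integralZl_EFin ?expR_ge0//; first last.
- apply/measurable_EFinP; apply: measurable_funM; last exact: measurable_half_pdf.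
  apply: measurableT_comp => //; apply: measurable_funM => //.
- by move=> g _; rewrite lee_fin mulr_ge0 ?expR_ge0 ?half_pdf_ge0.
rewrite half_pdf_sq// -EFinM lee_fin expRD ler_pM2l ?expR_gt0//.
rewrite -[leRHS]ger0_norm ?expR_ge0// -sqrtr_sqr -sqrtrV ?subr_ge0 ?(ltW l11)//.
apply: ler_wsqrtr; rewrite -[leLHS]mul1r ler_pdivrMr ?subr_gt0//.
have e1 : 1 + 2 * l <= expR l ^+ 2.
  by rewrite -expRM_natl; apply: le_trans (expR_ge1Dx _).
have l2 : 2 * l <= 1 by rewrite -ler_pdivlMl ?mulr1.
apply: (@le_trans _ _ ((1 + 2 * l) * (1 - l))).
  have : 0 <= l * (1 - 2 * l) by rewrite mulr_ge0// subr_ge0.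
  lra.
by rewrite ler_wpM2r// subr_ge0 ltW.
Qed.

End gauss_linearization.

(** * From the product rule on Borel sets to products of functions *)

Section independence.
Context d (T : measurableType d) (R : realType) (P : probability T R).

Lemma integral_indic_half_pdf (B : set R) : measurable B ->
  (\int[@lebesgue_measure R]_x (\1_B x * half_pdf x)%:E =
   normal_prob 0 (Num.sqrt (2%:R^-1)) B)%E.
Proof.
move=> mB; rewrite /normal_prob [RHS]integral_mkcond.
by apply: eq_integral => x _; rewrite patchE indicE; case: (x \in B); rewrite ?mul1r ?mul0r.
Qed.

(** Indicators are exchanged for general factors one index at a time; in the induction, [s] lists
    the indices already freed. One exchange freezes the other factors into a weight [G] and applies
    [integral_transfer] to [X i0], whose premise on Borel sets is the induction hypothesis. *)
Lemma indep_expectation (I : finType) (X : I -> T -> R) :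
  (forall i, measurable_fun setT (X i)) ->
  (forall B : I -> set R, (forall i, measurable (B i)) ->
    (\int[P]_w (\prod_i \1_(B i) (X i w))%:E =
     (\prod_i fine (normal_prob 0 (Num.sqrt (2%:R^-1)) (B i)))%:E)%E) ->
  forall (f : I -> R -> R) (c : I -> R),
  (forall i, measurable_fun setT (f i)) -> (forall i x, 0 <= f i x) ->
  (forall i, (\int[@lebesgue_measure R]_x (f i x * half_pdf x)%:E = (c i)%:E)%E) ->
  (\int[P]_w (\prod_i f i (X i w))%:E = (\prod_i c i)%:E)%E.
Proof.
move=> mX HX f c mf f0 fc.
suff : forall (s : seq I) (f : I -> R -> R) (c : I -> R),
  (forall i, measurable_fun setT (f i)) -> (forall i x, 0 <= f i x) ->
  (forall i, (\int[@lebesgue_measure R]_x (f i x * half_pdf x)%:E = (c i)%:E)%E) ->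
  (forall i, i \notin s -> exists2 B, measurable B & f i = \1_B) ->
  (\int[P]_w (\prod_i f i (X i w))%:E = (\prod_i c i)%:E)%E.
  by move=> /(_ (enum I)); apply => // i; rewrite mem_enum.
elim=> [|i0 s IH] {mf f0 fc c}f c mf f0 fc fs.
  have /choice[B HB] : forall i, exists B, measurable B /\ f i = \1_B.
    by move=> i; have [//|B mB fB] := fs i _; exists B.
  have cE i : c i = fine (normal_prob 0 (Num.sqrt (2%:R^-1)) (B i)).
    have [mB fB] := HB i.
    by have := fc i; rewrite fB integral_indic_half_pdf// => ->.
  rewrite (eq_bigr _ (fun i _ => cE i)) -HX; last by move=> i; case: (HB i).
  apply: eq_integral => w _; congr EFin; apply: eq_bigr => i _.
  by case: (HB i) => _ ->.
have c0 i : 0 <= c i.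
  rewrite -lee_fin -fc; apply: integral_ge0 => x _.
  by rewrite lee_fin mulr_ge0// half_pdf_ge0.
pose G w := \prod_(i | i != i0) f i (X i w).
pose k := \prod_(i | i != i0) c i.
transitivity (\int[P]_w (f i0 (X i0 w) * G w)%:E)%E.
  by apply: eq_integral => w _; rewrite (bigD1 i0).
have k0 : 0 <= k by apply: prodr_ge0.
rewrite (bigD1 i0)//= -/k.
rewrite (@integral_transfer _ _ _ _ _ P (@lebesgue_measure R) (X i0) G
  (fun x => k * half_pdf x) (f i0))//.
- transitivity (\int[@lebesgue_measure R]_y (k%:E * (f i0 y * half_pdf y)%:E))%E.
    by apply: eq_integral => y _; rewrite -EFinM mulrCA.
  rewrite ge0_integralZl_EFin//.
  + by rewrite fc -EFinM mulrC.
  + by move=> x _; rewrite lee_fin mulr_ge0// half_pdf_ge0.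
  + apply/measurable_EFinP; apply: measurable_funM; [exact: mf|exact: measurable_half_pdf].
- exact: mX.
- rewrite /G; under eq_fun do rewrite -big_filter.
  by apply: measurable_prod => i _; exact: (measurableT_comp (mf i) (mX i)).
- by apply: measurable_funM; [exact: measurable_cst|exact: measurable_half_pdf].
- exact: mf.
- by move=> w; apply: prodr_ge0.
- by move=> y; rewrite mulr_ge0// half_pdf_ge0.
move=> B mB.
pose f' i := if i == i0 then \1_B else f i.
pose c' i := if i == i0 then fine (normal_prob 0 (Num.sqrt (2%:R^-1)) B) else c i.
have gB : normal_prob 0 (Num.sqrt (2%:R^-1)) B = (c' i0)%:E.
  by rewrite /c' eqxx fineK// fin_num_measure.
have := IH f' c'; rewrite (bigD1 i0)//= [X in ((c' i0 * X)%:E)%E](_ : _ = k); last first.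
  by apply: eq_bigr => i /negbTE ii0; rewrite /c' ii0.
move=> IH'; transitivity ((c' i0 * k)%:E).
  rewrite -IH'.
  - apply: eq_integral => w _; rewrite (bigD1 i0)//= {1}/f' eqxx; congr (_ * _)%:E.
    by apply: eq_bigr => i /negbTE ii0; rewrite /f' ii0.
  - by move=> i; rewrite /f'; case: ifP => // _; exact: measurable_indic.
  - by move=> i x; rewrite /f'; case: ifP.
  - move=> i; rewrite /f'; have [->|/negbTE ii0] := eqVneq i i0.
      by rewrite integral_indic_half_pdf.
    by rewrite fc /c' ii0.
  - move=> i; rewrite /f'; have [->|ii0 is0] := eqVneq i i0; first by exists B.
    by apply: fs; rewrite inE negb_or ii0.
transitivity (\int[@lebesgue_measure R]_y (k%:E * (\1_B y * half_pdf y)%:E))%E; last first.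
  by apply: eq_integral => y _; rewrite -EFinM mulrCA.
rewrite ge0_integralZl_EFin//.
- by rewrite integral_indic_half_pdf// gB -EFinM mulrC.
- by move=> x _; rewrite lee_fin mulr_ge0// half_pdf_ge0.
- by apply/measurable_EFinP; apply: measurable_funM; [exact: measurable_indic|exact: measurable_half_pdf].
Qed.

End independence.

Lemma big_pair_bool (I : finType) (V : Type) (e : V) (op : Monoid.com_law e)
  (F : I * bool -> V) :
  \big[op/e]_p F p = \big[op/e]_i (op (F (i, false)) (F (i, true))).
Proof.
transitivity (\big[op/e]_i \big[op/e]_(b : bool) F (i, b)).
  by rewrite pair_big; apply: eq_bigr => -[].
by apply: eq_bigr => i _; rewrite big_bool Monoid.mulmC.
Qed.

(** * Real and imaginary parts, and symmetric sums *)

Section complex_basics.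
Context {R : realType}.
Local Notation C := R[i].
Local Notation normc := Normc.normc.

Lemma normc_sqrE (z : C) : normc z ^+ 2 = complex.Re z ^+ 2 + complex.Im z ^+ 2.
Proof. by case: z => a b; rewrite /= sqr_sqrtr// addr_ge0 ?sqr_ge0. Qed.

Lemma complex_ReD (x y : C) : complex.Re (x + y) = complex.Re x + complex.Re y.
Proof. by case: x; case: y. Qed.

Lemma complex_ImD (x y : C) : complex.Im (x + y) = complex.Im x + complex.Im y.
Proof. by case: x; case: y. Qed.

Lemma complex_ReM (x y : C) : complex.Re (x * y) =
  complex.Re x * complex.Re y - complex.Im x * complex.Im y.
Proof. by case: x; case: y. Qed.

Lemma complex_ImM (x y : C) : complex.Im (x * y) =
  complex.Re x * complex.Im y + complex.Im x * complex.Re y.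
Proof. by case: x => a b; case: y. Qed.

Lemma complex_Re_sum (I : Type) (r : seq I) (Q : pred I) (F : I -> C) :
  complex.Re (\sum_(i <- r | Q i) F i) = \sum_(i <- r | Q i) complex.Re (F i).
Proof. exact: (big_morph _ complex_ReD erefl). Qed.

Lemma complex_Im_sum (I : Type) (r : seq I) (Q : pred I) (F : I -> C) :
  complex.Im (\sum_(i <- r | Q i) F i) = \sum_(i <- r | Q i) complex.Im (F i).
Proof. exact: (big_morph _ complex_ImD erefl). Qed.

Lemma eq_symsum (V : nmodType) p (F G : int -> V) :
  (forall t : int, (`|t| <= p%:Z)%R -> F t = G t) -> symsum p F = symsum p G.
Proof.
move=> FG; apply: eq_bigr => i _; apply: FG.
by have := ltn_ord i; lia.
Qed.

End complex_basics.

(** * Exponential moments of linear and quadratic forms of the noise *)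

Section gauss_chaos.
Context d (T : measurableType d) (R : realType) (P : probability T R).
Context (xi : int -> T -> R[i]) (N : nat).
Hypothesis xiP : iid_std_cgauss P xi N.
Local Notation normc := Normc.normc.

Lemma prod_indic (I : finType) (S : I -> set T) w :
  \prod_i (\1_(S i) w : R) = \1_[set w | forall i, S i w] w.
Proof.
rewrite [RHS]indicE; have [/set_mem|/negP] := boolP (w \in _).
  by move=> /= H; rewrite big1// => i _; rewrite indicE mem_set.
move=> H; have [i Hi] : exists i, ~ S i w.
  by apply/existsNP => H'; apply: H; rewrite inE.
by rewrite (bigD1 i)//= indicE memNset// mul0r.
Qed.

(** Re (b xi) = Re b Re xi - Im b Im xi splits the integrand into factors of single real variables
    of variance 1/2, and a factor with coefficient c integrates to exp (c^2 / 4). *)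
Lemma iid_mgf (b : int -> R[i]) :
  (\int[P]_w (expR (complex.Re (symsum N (fun t => b t * xi t w))))%:E =
   (expR (symsum N (fun t => normc (b t) ^+ 2) / 4))%:E)%E.
Proof.
case: xiP => mxi indep.
pose I := ('I_(2 * N).+1 * bool)%type.
pose tm (i : 'I_(2 * N).+1) : int := i%:Z - N%:Z.
have tmN i : (`|tm i| <= N%:Z)%R by rewrite /tm; have := ltn_ord i; lia.
pose X (p : I) w := if p.2 then complex.Im (xi (tm p.1) w) else complex.Re (xi (tm p.1) w).
have mX p : measurable_fun setT (X p).
  by case: p => i [] ; rewrite /X/=; have [] := mxi _ (tmN i).
pose f (p : I) x := expR ((if p.2 then - complex.Im (b (tm p.1)) else complex.Re (b (tm p.1))) * x).
pose c (p : I) := expR ((if p.2 then - complex.Im (b (tm p.1)) else complex.Re (b (tm p.1))) ^+ 2 / 4).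
have := @indep_expectation _ T R P I X mX _ f c.
have -> : (\prod_p c p = expR (symsum N (fun t => normc (b t) ^+ 2) / 4)).
  rewrite /c -expR_sum; congr expR; rewrite big_pair_bool /symsum mulr_suml.
  by apply: eq_bigr => i _; rewrite normc_sqrE/= sqrrN mulrDl.
have -> : (\int[P]_w (\prod_i f i (X i w))%:E = \int[P]_w (expR (complex.Re (symsum N (fun t => b t * xi t w))))%:E)%E.
  apply: eq_integral => w _; congr EFin; rewrite /f -expR_sum; congr expR.
  rewrite big_pair_bool /symsum complex_Re_sum; apply: eq_bigr => i _.
  by rewrite complex_ReM/= mulNr.
apply.
- move=> B mB.
  (* The hypothesis indexes Borel sets by integers, the product by ordinals; [inord] inverts [tm] on
     the window, and its default value elsewhere never enters. *)
  pose B1 (t : int) := B (inord (absz (t + N%:Z)%R), false).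
  pose B2 (t : int) := B (inord (absz (t + N%:Z)%R), true).
  have tmK i : inord (absz (tm i + N%:Z)%R) = i.
    by apply: val_inj; rewrite /= /tm subrK absz_nat inordK.
  have m12 t : measurable (B1 t) /\ measurable (B2 t) by split; exact: mB.
  have := indep B1 B2 m12.
  set A := (X in P X) => PA.
  have AE : A = [set w | forall p : I, (X p @^-1` B p) w].
    apply/seteqP; split => w.
      move=> Aw [i e]; have [] := Aw (tm i) (tmN i).
      by rewrite /B1 /B2 tmK => ? ?; case: e.
    move=> Aw t /= tN.
    have lt : (absz (t + N%:Z)%R < (2 * N).+1)%N by lia.
    have tE : tm (inord (absz (t + N%:Z)%R)) = t by rewrite /tm inordK//; lia.
    split.
      by have := Aw (inord (absz (t + N%:Z)%R), false); rewrite /X/= tE.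
    by have := Aw (inord (absz (t + N%:Z)%R), true); rewrite /X/= tE.
  have mA : measurable A.
    rewrite AE (_ : [set _ | _] = \bigcap_(p in [set: I]) (X p @^-1` B p)); last first.
      by apply/seteqP; split => w /= H p; [move=> _; exact: H|exact: H].
    apply: fin_bigcap_measurable => [|p _]; first exact: finite_finset.
    by rewrite -[X in measurable X]setTI; exact: mX.
  transitivity (\int[P]_w (\1_A w)%:E)%E.
    apply: eq_integral => w _; congr EFin; rewrite AE -prod_indic.
    by apply: eq_bigr => p _; rewrite !indicE; congr (_%:R).
  rewrite integral_indic// setIT big_pair_bool; apply: (etrans PA).
  rewrite (big_morph EFin (@EFinM R) erefl); apply: eq_bigr => i _.
  rewrite /= /B1 /B2 -/(tm i) tmK EFinM !fineK//; by apply: fin_num_measure; exact: mB.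
- move=> p; rewrite /f; apply: measurableT_comp => //; exact: measurable_funM.
- by move=> p x; exact: expR_ge0.
- by move=> p; exact: half_pdf_mgf.
Qed.

Lemma measurable_Re_lin (b : int -> R[i]) :
  measurable_fun setT (fun w => complex.Re (symsum N (fun t => b t * xi t w))).
Proof.
under eq_fun do rewrite /symsum complex_Re_sum.
apply: measurable_sum => i; under eq_fun do rewrite complex_ReM.
have tN : (`|i%:Z - N%:Z| <= N%:Z)%R by have := ltn_ord i; lia.
have [m1 m2] := xiP.1 _ tN.
by apply: measurable_funB; apply: measurable_funM.
Qed.

Lemma measurable_Im_lin (b : int -> R[i]) :
  measurable_fun setT (fun w => complex.Im (symsum N (fun t => b t * xi t w))).
Proof.
under eq_fun do rewrite /symsum complex_Im_sum.
apply: measurable_sum => i; under eq_fun do rewrite complex_ImM.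
have tN : (`|i%:Z - N%:Z| <= N%:Z)%R by have := ltn_ord i; lia.
have [m1 m2] := xiP.1 _ tN.
by apply: measurable_funD; apply: measurable_funM.
Qed.

Lemma measurable_normc_lin (b : int -> R[i]) :
  measurable_fun setT (fun w => normc (symsum N (fun t => b t * xi t w)) ^+ 2).
Proof.
under eq_fun do rewrite normc_sqrE.
by apply: measurable_funD; apply: measurable_funX;
  [exact: measurable_Re_lin|exact: measurable_Im_lin].
Qed.

(* G stands for the auxiliary Gaussian vector linearizing the squares; after
   integrating out the noise only a Bessel-type bound on the vectors v j matters. *)
Lemma iid_chaos_mgf (J : eqType) (s : seq J) (v : J -> int -> R[i]) (lam : J -> R)
  (b : int -> R[i]) (q : R) : uniq s -> (forall j, 0 <= lam j <= 2^-1) ->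
  (forall G : J -> R[i],
    symsum N (fun t => normc (b t + 2 * \sum_(j <- s) G j * v j t) ^+ 2) / 4 <=
    q + \sum_(j <- s) lam j * normc (G j) ^+ 2) ->
  (\int[P]_w (expR (complex.Re (symsum N (fun t => b t * xi t w)) +
     \sum_(j <- s) normc (symsum N (fun t => v j t * xi t w)) ^+ 2))%:E <=
   (expR (q + 2 * \sum_(j <- s) lam j))%:E)%E.
Proof.
move=> + lam01; elim: s b q => [|j s IH] b q /=.
  move=> _ /(_ (fun _ => 0)); rewrite big_nil addr0 => H.
  under eq_integral do rewrite big_nil addr0.
  rewrite iid_mgf lee_fin ler_expR big_nil mulr0 addr0.
  apply: le_trans H; rewrite ler_pM2r ?invr_gt0//.
  rewrite le_eqVlt; apply/orP; left; apply/eqP/eq_bigr => i _.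
  by rewrite big_nil mulr0 addr0.
move=> /andP[js us] H.
pose z w := symsum N (fun t => v j t * xi t w).
pose Y0 w := complex.Re (symsum N (fun t => b t * xi t w)) +
     \sum_(k <- s) normc (symsum N (fun t => v k t * xi t w)) ^+ 2.
have mY0 : measurable_fun setT Y0.
  apply: measurable_funD; first exact: measurable_Re_lin.
  by apply: measurable_sum => k; exact: measurable_normc_lin.
have mRe : measurable_fun setT (fun w => complex.Re (z w)) by exact: measurable_Re_lin.
have mIm : measurable_fun setT (fun w => complex.Im (z w)) by exact: measurable_Im_lin.
rewrite (_ : (\int[P]_w _)%E = (\int[P]_w (expR ((Y0 w + complex.Re (z w) ^+ 2) + complex.Im (z w) ^+ 2))%:E)%E); last first.
  apply: eq_integral => w _; rewrite big_cons normc_sqrE -/(z w) /Y0.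
  by congr (expR _)%:E; ring.
rewrite (_ : q + _ = (q + 2 * \sum_(k <- s) lam k + lam j) + lam j); last by rewrite big_cons; ring.
apply: gauss_linearize => //.
  by apply: measurable_funD => //; exact: measurable_funX.
move=> g.
rewrite (_ : (\int[P]_w _)%E = (\int[P]_w (expR ((Y0 w + 2 * g * complex.Im (z w)) + complex.Re (z w) ^+ 2))%:E)%E); last first.
  by apply: eq_integral => w _; congr (expR _)%:E; ring.
rewrite (_ : q + _ + _ + _ = (q + 2 * \sum_(k <- s) lam k + lam j * g ^+ 2) + lam j); last by ring.
apply: gauss_linearize => //.
  by apply: measurable_funD => //; exact: measurable_funM.
(* The two auxiliary variables, for the real and the imaginary part of z, merge into one complex
   coefficient: Re (c z) = g' Re z + g Im z. Two linearizations per form explain the factor 2 before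
   the sum of [lam]. *)
move=> g'; pose c : R[i] := Complex g' (- g).
have := IH (fun t => b t + 2 * (c * v j t)) (q + lam j * (g' ^+ 2 + g ^+ 2)) us.
have cE : normc c ^+ 2 = g' ^+ 2 + g ^+ 2 by rewrite normc_sqrE/= sqrrN.
have -> : q + lam j * (g' ^+ 2 + g ^+ 2) + 2 * \sum_(k <- s) lam k =
  q + 2 * \sum_(k <- s) lam k + lam j * g ^+ 2 + lam j * g' ^+ 2 by ring.
rewrite (_ : (\int[P]_w _)%E = (\int[P]_w (expR (Y0 w + 2 * g * complex.Im (z w) + 2 * g' * complex.Re (z w)))%:E)%E); last first.
  apply: eq_integral => w _; congr (expR _)%:E; rewrite /Y0.
  rewrite (_ : symsum N (fun t => (b t + 2 * (c * v j t)) * xi t w) =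
    symsum N (fun t => b t * xi t w) + 2 * (c * z w)).
    rewrite complex_ReD complex_ReM complex_ReM/=.
    by ring.
  rewrite /z /symsum !mulr_sumr -big_split/=; apply: eq_bigr => i _.
  by ring.
apply=> G.
have := H (fun k => if k == j then c else G k).
rewrite !big_cons eqxx cE.
have E1 : \sum_(k <- s) lam k * normc (if k == j then c else G k) ^+ 2 =
          \sum_(k <- s) lam k * normc (G k) ^+ 2.
  by apply: eq_big_seq => k ks; case: eqP => // kj; rewrite -kj ks in js.
rewrite E1 addrA => H'; apply: le_trans H'.
rewrite ler_pM2r ?invr_gt0// le_eqVlt; apply/orP; left; apply/eqP/eq_bigr => i _.
congr (normc _ ^+ 2); rewrite big_cons eqxx mulrDr addrA; congr (_ + _ * _).
by apply: eq_big_seq => k ks; case: eqP => // kj; rewrite -kj ks in js.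
Qed.

End gauss_chaos.

(** * Chernoff bound for a finite family *)

Section chernoff_family.
Context d (T : measurableType d) (R : realType) (P : probability T R).

(** Markov's inequality for the single variable [Z], the sum of all normalized exponentials, handles
    the union at once: where [Z] is below 1, so is each of its terms. *)
Lemma chernoff_family (I : finType) (X : I -> T -> R) (a L : I -> R) :
  (forall i, measurable_fun setT (X i)) ->
  (forall i, (\int[P]_w (expR (X i w))%:E <= (expR (a i))%:E)%E) ->
  exists A : set T, [/\ measurable A, (P A <= (\sum_i expR (- L i))%:E)%E &
    forall w, ~ A w -> forall i, X i w < a i + L i].
Proof.
move=> mX EX; pose Z w := \sum_i expR (X i w - (a i + L i)).
have mE i : measurable_fun setT (fun w => expR (X i w - (a i + L i))).
  by apply: measurableT_comp => //; exact: measurable_funB.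
have mZ : measurable_fun setT Z by exact: measurable_sum.
have mA : measurable [set w | 1 <= Z w].
  rewrite (_ : [set _ | _] = Z @^-1` `[1, +oo[).
    by rewrite -[X in measurable X]setTI; exact: mZ.
  by apply/seteqP; split => y /=; rewrite in_itv/= andbT.
exists [set w | 1 <= Z w]; split => //.
  rewrite -(setIT [set w | _]) -integral_indic//.
  apply: (@le_trans _ _ (\int[P]_w (Z w)%:E)%E).
    apply: ge0_le_integral => //.
    - by apply/measurable_EFinP; exact: measurable_indic.
    - exact/measurable_EFinP.
    - move=> w _; rewrite lee_fin indicE; have [/set_mem//|_] := boolP (w \in _).
      by apply: sumr_ge0 => i _; exact: expR_ge0.
  rewrite /Z; under eq_integral do rewrite -sumEFin.
  rewrite ge0_integral_sum//; last first.
    by move=> i; exact/measurable_EFinP.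
  rewrite -sumEFin; apply: lee_sum => i _.
  under eq_integral do rewrite expRD mulrC EFinM.
  rewrite ge0_integralZl_EFin ?expR_ge0//; last first.
    by apply/measurable_EFinP; apply: measurableT_comp.
  apply: (@le_trans _ _ ((expR (- (a i + L i)))%:E * (expR (a i))%:E)%E).
    by apply: lee_pmul => //; apply: integral_ge0 => w _; rewrite lee_fin expR_ge0.
  by rewrite -EFinM -expRD lee_fin ler_expR opprD addrAC addNr add0r.
move=> w /negP; rewrite -ltNge => Z1 i.
rewrite ltNge; apply/negP => h; move: Z1; apply/negP; rewrite -leNgt /Z (bigD1 i)//=.
apply: (@le_trans _ _ (expR (X i w - (a i + L i)))).
  by rewrite -[leLHS]expR0 ler_expR subr_ge0.
by rewrite lerDl; apply: sumr_ge0 => j _; exact: expR_ge0.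
Qed.

End chernoff_family.

(** * Roots of unity, Parseval and Bessel *)

Section roots_of_unity.
Context {R : realType}.
Local Notation C := R[i].
Local Notation normc := Normc.normc.

Lemma conjcM (x y : C) : conjc (x * y) = conjc x * conjc y.
Proof. exact: rmorphM. Qed.

Lemma conjc_sum (I : Type) (r : seq I) (Q : pred I) (F : I -> C) :
  conjc (\sum_(i <- r | Q i) F i) = \sum_(i <- r | Q i) conjc (F i).
Proof. exact: rmorph_sum. Qed.

Lemma normc_sqr_conj (z : C) : (normc z ^+ 2)%:C%C = z * conjc z.
Proof.
rewrite normc_sqrE; case: z => a b; apply/eqP; rewrite eq_complex/=.
by apply/andP; split; apply/eqP; ring.
Qed.

Lemma normc_ge0 (z : C) : 0 <= normc z.
Proof. by case: z => a b; exact: sqrtr_ge0. Qed.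

Lemma normc_conj (z : C) : normc (conjc z) = normc z.
Proof. by case: z => a b /=; rewrite sqrrN. Qed.

Lemma normc_real (x : R) : normc x%:C%C = `|x|.
Proof. by rewrite /= expr0n/= addr0 sqrtr_sqr. Qed.

Lemma ler_normc_sum (I : Type) (r : seq I) (Q : pred I) (F : I -> C) :
  normc (\sum_(i <- r | Q i) F i) <= \sum_(i <- r | Q i) normc (F i).
Proof.
elim/big_ind2: _ => [|x y z t xy zt|//]; first by rewrite Normc.normc0.
by apply: le_trans (le_normcD _ _) _; exact: lerD.
Qed.

Lemma Re_le_normc (z : C) : `|complex.Re z| <= normc z.
Proof.
by case: z => a b /=; rewrite -sqrtr_sqr; apply: ler_wsqrtr; rewrite lerDl sqr_ge0.
Qed.

Lemma expiD (x y : R) : expi (x + y) = expi x * expi y.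
Proof.
by apply/eqP; rewrite eq_complex/= cosD sinD addrC; apply/andP; split; apply/eqP; ring.
Qed.

Lemma expi0 : expi 0 = 1 :> C.
Proof. by rewrite /expi cos0 sin0. Qed.

Lemma normc_expi (x : R) : normc (expi x) = 1.
Proof. by rewrite /= cos2Dsin2 sqrtr1. Qed.

Lemma conjc_expi (x : R) : conjc (expi x) = expi (- x).
Proof. by rewrite /expi cosN sinN. Qed.

Lemma normc_1Bexpi (x : R) : normc (1 - expi x) = 2 * `|sin (x / 2)|.
Proof.
have -> : 2 * `|sin (x / 2)| = Num.sqrt ((2 * sin (x / 2)) ^+ 2).
  by rewrite sqrtr_sqr normrM ger0_norm.
rewrite /=; congr Num.sqrt; have := cos2Dsin2 x.
have -> : cos x = 1 - 2 * sin (x / 2) ^+ 2.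
  have {1}-> : x = x / 2 + x / 2 by lra.
  by rewrite cosD; have := cos2Dsin2 (x / 2); rewrite -!expr2; lra.
by rewrite sub0r sqrrN => /(canRL (addKr _)) ->; ring.
Qed.

Definition ew (M : nat) (j : int) : C := expi (2 * pi * j%:~R / M%:R).

Lemma ewD M j k : ew M (j + k) = ew M j * ew M k.
Proof. by rewrite /ew -expiD intrD mulrDr mulrDl. Qed.

Lemma ew0 M : ew M 0 = 1. Proof. by rewrite /ew mulr0 mul0r expi0. Qed.

Lemma normc_ew M j : normc (ew M j) = 1. Proof. exact: normc_expi. Qed.

Lemma conjc_ew M j : conjc (ew M j) = ew M (- j).
Proof. by rewrite /ew conjc_expi mulrNz mulrN mulNr. Qed.

Lemma ewX M (j : int) n : ew M (j * n%:Z) = ew M j ^+ n.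
Proof.
elim: n => [|n IH]; first by rewrite mulr0 ew0 expr0.
by rewrite intS mulrDr mulr1 ewD IH exprS.
Qed.

Lemma ew_period M (k : int) : (0 < M)%N -> ew M (M%:Z * k) = 1.
Proof.
move=> M0; have M1 : ew M M%:Z = 1.
  by rewrite /ew -mulrA mulfV ?pnatr_eq0 -?lt0n// mulr1 mulr_natl /expi cos2pi sin2pi.
case: k => n; first by rewrite ewX M1 expr1n.
by rewrite NegzE mulrN -conjc_ew ewX M1 expr1n conjc1.
Qed.

Lemma ew_neq1 M (j : int) : (0 < `|j| < M)%N -> ew M j != 1.
Proof.
move=> jM; have M0 : (0 : R) < M%:R by rewrite ltr0n; lia.
have main (i : nat) : (0 < i < M)%N -> ew M i%:Z != 1.
  move=> /andP[i0 iM]; rewrite eq_sym -subr_eq0; apply/negP => /eqP h.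
  have := normc_1Bexpi (2 * pi * (i%:Z)%:~R / M%:R).
  rewrite -/(ew M i%:Z) h Normc.normc0 => /esym/eqP; rewrite mulf_eq0 pnatr_eq0/= normr_eq0.
  apply/negP; rewrite gt_eqF//; apply: sin_gt0_pi.
  have -> : 2 * pi * (i%:Z)%:~R / M%:R / 2 = pi * (i%:R / M%:R) :> R.
    by rewrite -pmulrn; field; rewrite gt_eqF.
  apply/andP; split.
    by rewrite mulr_gt0 ?pi_gt0// divr_gt0// ltr0n.
  by rewrite gtr_pMr ?pi_gt0// ltr_pdivrMr// mul1r ltr_nat.
case: j jM => n jM; first exact: main.
rewrite NegzE -conjc_ew; apply/negP => /eqP /(congr1 conjc); rewrite conjcK conjc1.
by apply/eqP; apply: main; lia.
Qed.

Lemma sum_ew M (j : int) : (0 < M)%N -> (`|j| < M)%N ->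
  \sum_(i < M) ew M (j * i%:Z) = M%:R *+ (j == 0).
Proof.
move=> M0 jM; have [->|j0] := eqVneq j 0.
  under eq_bigr do rewrite mul0r ew0.
  by rewrite sumr_const card_ord mulr1n.
under eq_bigr do rewrite ewX.
have q1 : ew M j - 1 != 0 by rewrite subr_eq0 ew_neq1//; lia.
by apply: (mulfI q1); rewrite -subrX1 -ewX (mulrC j) ew_period// subrr mulr0n mulr0.
Qed.

Lemma parseval M (G : nat -> C) : (0 < M)%N ->
  \sum_(t < M) normc (\sum_(f < M) G f * ew M (f%:Z * t%:Z)) ^+ 2 =
  M%:R * \sum_(f < M) normc (G f) ^+ 2.
Proof.
move=> M0; apply: complexI; rewrite rmorphM/= !rmorph_sum/= rmorph_nat.
under eq_bigr => t _.
  rewrite normc_sqr_conj conjc_sum mulr_suml.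
  under eq_bigr => f _ do rewrite mulr_sumr.
  over.
rewrite exchange_big/= mulr_sumr; apply: eq_bigr => f _.
rewrite exchange_big/= (bigD1 f)//= [X in _ + X]big1 ?addr0.
  under eq_bigr => t _ do rewrite conjcM conjc_ew mulrACA -ewD subrr ew0 mulr1 -normc_sqr_conj.
  by rewrite sumr_const card_ord mulr_natl.
move=> g gf.
under eq_bigr => t _ do rewrite conjcM conjc_ew mulrACA -ewD -mulrBl.
rewrite -mulr_sumr sum_ew//; last by have := ltn_ord f; have := ltn_ord g; lia.
rewrite (_ : (_ == 0) = false) ?mulr0n ?mulr0//.
by apply/negP => /eqP h; move/eqP: gf; apply; apply: val_inj => /=; lia.
Qed.

(** The window covers at most one period, and its position only rotates the coefficients by
    unimodular factors; the rest of the period adds nonnegative terms to Parseval's identity. *)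
Lemma bessel M p (G : nat -> C) (h : int) : (2 * p < M)%N ->
  symsum p (fun t => normc (\sum_(f < M) G f * ew M (f%:Z * (t + h))) ^+ 2) <=
  M%:R * \sum_(f < M) normc (G f) ^+ 2.
Proof.
move=> pM; have M0 : (0 < M)%N by lia.
pose G' f := G f * ew M (f%:Z * (h - p%:Z)).
have -> : \sum_(f < M) normc (G f) ^+ 2 = \sum_(f < M) normc (G' f) ^+ 2.
  by apply: eq_bigr => f _; rewrite /G' Normc.normcM normc_ew mulr1.
rewrite -parseval// /symsum.
have -> : \sum_(i < (2 * p).+1) normc (\sum_(f < M) G f * ew M (f%:Z * (i%:Z - p%:Z + h))) ^+ 2 =
  \sum_(i < (2 * p).+1) normc (\sum_(f < M) G' f * ew M (f%:Z * i%:Z)) ^+ 2.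
  apply: eq_bigr => i _; congr (normc _ ^+ 2); apply: eq_bigr => f _.
  by rewrite /G' -mulrA -ewD; congr (_ * ew _ _); ring.
rewrite -[leLHS](big_mkord xpredT (fun i => normc (\sum_(f < M) G' f * ew M (f%:Z * i%:Z)) ^+ 2)).
rewrite -[leRHS](big_mkord xpredT (fun i => normc (\sum_(f < M) G' f * ew M (f%:Z * i%:Z)) ^+ 2)).
rewrite [leRHS](@big_cat_nat _ _ _ (2 * p).+1)//=.
by rewrite lerDl; apply: sumr_ge0 => i _; exact: sqr_ge0.
Qed.

End roots_of_unity.

(** * Convolution as multiplication on the doubled circle *)

Section block_dft.
Context {R : realType}.
Local Notation C := R[i].
Local Notation normc := Normc.normc.

Lemma exchange_symsum (V : nmodType) p q (F : int -> int -> V) :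
  symsum p (fun t => symsum q (F t)) = symsum q (fun s => symsum p (fun t => F t s)).
Proof. exact: exchange_big. Qed.

Lemma symsum_delta (V : nmodType) (p : nat) (F : int -> V) (t0 : int) : (`|t0| <= p%:Z)%R ->
  symsum p (fun t => F t *+ (t == t0)) = F t0.
Proof.
move=> t0p; have ip : (absz (t0 + p%:Z)%R < (2 * p).+1)%N by lia.
rewrite /symsum (bigD1 (Ordinal ip))//= big1 ?addr0.
  have -> : (absz (t0 + p%:Z)%R)%:Z - p%:Z = t0 by lia.
  by rewrite eqxx.
move=> i /eqP ii; rewrite (_ : (_ == t0) = false)//; apply/negP => /eqP h.
by apply: ii; apply: val_inj => /=; lia.
Qed.

Definition dtft (M p : nat) (u : cseq R) (f : nat) : C :=
  symsum p (fun t => u t * ew M (- (f%:Z * t))).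

Definition window (J : int -> bool) (u : cseq R) : cseq R := fun t => u t *+ J t.

Section block.
Variables (m : nat) (phi u : cseq R).
Let M := (2 * (2 * m).+1)%N.

(** With |t|, |s| <= m and |r| <= 2m, the difference t - s - r has modulus at most 4m < M, so
    orthogonality of characters selects exactly r = t - s. *)
Lemma conv_dft (t : int) : (`|t| <= m%:Z)%R ->
  M%:R * Defs.conv m phi u t =
  \sum_(f < M) dtft M m phi f * dtft M (2 * m) u f * ew M (f%:Z * t).
Proof.
move=> tm; have M0 : (0 < M)%N by rewrite /M; lia.
transitivity (\sum_(f < M) symsum m (fun s => symsum (2 * m) (fun r =>
    phi s * u r * ew M ((t - s - r) * f%:Z)))).
  rewrite exchange_big/= /Defs.conv /symsum mulr_sumr; apply: eq_bigr => i _.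
  set s := i%:Z - m%:Z.
  have sm : (`|s| <= m%:Z)%R by rewrite /s; have := ltn_ord i; lia.
  rewrite exchange_big/=.
  rewrite -[RHS]/(symsum (2 * m) (fun r => \sum_(f < M) phi s * u r * ew M ((t - s - r) * f%:Z))).
  rewrite mulrCA -(@symsum_delta _ (2 * m) u (t - s)) ?mulr_sumr /symsum; last by lia.
  apply: eq_bigr => j _; set r := j%:Z - _.
  have rm : (`|r| <= (2 * m)%:Z)%R by rewrite /r; have := ltn_ord j; lia.
  rewrite -mulr_sumr sum_ew//; last by rewrite /M; lia.
  rewrite subr_eq0 (eq_sym r); case: eqP => _; last by rewrite !mulr0n !mulr0.
  by rewrite !mulr1n; ring.
apply: eq_bigr => f _; rewrite /dtft /symsum mulr_suml mulr_suml.
apply: eq_bigr => i _; rewrite mulr_sumr mulr_suml; apply: eq_bigr => j _.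
set s := i%:Z - _; set r := j%:Z - _.
have -> : (t - s - r) * f%:Z = - (f%:Z * s) + (- (f%:Z * r) + f%:Z * t) by ring.
by rewrite !ewD; ring.
Qed.

Let MR0 : (0 : R) < M%:R. Proof. by rewrite ltr0n /M; lia. Qed.

(** The pairing becomes a sum of the response times two different Fourier coefficients of the noise;
    the arithmetic-geometric inequality separates them into squares, so that the response multiplies
    nonnegative weights free of [phi]. *)
Lemma block_cross (J : int -> bool) :
  M%:R * normc (symsum m (fun t => window J (fun t => conjc (u t)) t * Defs.conv m phi u t)) <=
  \sum_(f < M) normc (dtft M m phi f) *
    ((normc (dtft M m (window J u) f) ^+ 2 + normc (dtft M (2 * m) u f) ^+ 2) / 2).
Proof.
have -> : M%:R * normc (symsum m (fun t => window J (fun t => conjc (u t)) t * Defs.conv m phi u t)) =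
  normc (\sum_(f < M) dtft M m phi f * dtft M (2 * m) u f * conjc (dtft M m (window J u) f)).
  have -> : \sum_(f < M) dtft M m phi f * dtft M (2 * m) u f * conjc (dtft M m (window J u) f) =
      M%:R * symsum m (fun t => window J (fun t => conjc (u t)) t * Defs.conv m phi u t).
    rewrite /symsum mulr_sumr.
    under eq_bigr => f _ do rewrite [dtft M m (window J u) f]/dtft /symsum conjc_sum mulr_sumr.
    rewrite exchange_big/=; apply: eq_bigr => i _; set t := i%:Z - _.
    have tm : (`|t| <= m%:Z)%R by rewrite /t; have := ltn_ord i; lia.
    rewrite mulrCA conv_dft// mulr_sumr; apply: eq_bigr => f _.
    rewrite conjcM conjc_ew opprK /window; case: (J t); rewrite ?mulr1n ?mulr0n ?conjc0; ring.
  rewrite Normc.normcM; congr (_ * _).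
  by rewrite -(rmorph_nat (real_complex R)) normc_real ger0_norm.
apply: le_trans (ler_normc_sum _ _ _) _; apply: ler_sum => f _.
rewrite !Normc.normcM normc_conj -mulrA; apply: ler_wpM2l; first exact: normc_ge0.
set a := normc _; set b := normc _.
by have := sqr_ge0 (a - b); rewrite sqrrB; lra.
Qed.

Lemma block_energy :
  M%:R * symsum m (fun t => normc (Defs.conv m phi u t) ^+ 2) <=
  \sum_(f < M) normc (dtft M m phi f) ^+ 2 * normc (dtft M (2 * m) u f) ^+ 2.
Proof.
have := @bessel R M m (fun f => dtft M m phi f * dtft M (2 * m) u f) 0.
rewrite {1}/M => /(_ ltac:(lia)).
under [X in _ <= _ * X -> _]eq_bigr do rewrite Normc.normcM exprMn.
rewrite (@eq_symsum _ _ _ (fun t => M%:R ^+ 2 * normc (Defs.conv m phi u t) ^+ 2)).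
  by rewrite /symsum -mulr_sumr expr2 -mulrA ler_pM2l.
move=> t tm; rewrite -exprMn; congr (_ ^+ 2).
rewrite addr0 -conv_dft// Normc.normcM; congr (_ * _).
by rewrite -(rmorph_nat (real_complex R)) normc_real ger0_norm.
Qed.

End block.
End block_dft.

(** * Sine bounds, harmonic sums and an extremal problem for weighted sums *)

Section elementary_bounds.
Context {R : realType}.

(** The mean value theorem on both sides of y stands in for concavity: the slope of the sine before
    y exceeds its slope after y. *)
Lemma jordan (y : R) : 0 <= y <= pi / 2 -> 2 * y <= pi * sin y.
Proof.
move=> /andP[]; rewrite le_eqVlt => /orP[/eqP <- _|y0]; first by rewrite sin0 !mulr0.
rewrite le_eqVlt => /orP[/eqP ->|y1]; first by rewrite sin_pihalf; lra.
have cs (a b : R) : {within `[a, b], continuous (@sin R)}.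
  by apply: continuous_subspaceT => x; exact: continuous_sin.
have [c1 c1P e1] := MVT y0 (fun x _ => is_derive_sin x) (cs 0 y).
have [c2 c2P e2] := MVT y1 (fun x _ => is_derive_sin x) (cs y (pi / 2)).
move: c1P c2P; rewrite !in_itv/= => /andP[c10 c1y] /andP[c2y c2p].
have pi0 := @pi_gt0 R.
have cc : cos c2 < cos c1 by rewrite ltr_cos ?in_itv/=; lra.
rewrite sin0 !subr0 in e1; rewrite sin_pihalf in e2.
have : cos c2 * ((pi / 2 - y) * y) <= cos c1 * ((pi / 2 - y) * y).
  by rewrite ler_wpM2r ?ltW// mulr_gt0//; lra.
nra.
Qed.

Lemma sin_pi_ge (x : R) : 0 < x < 1 -> 2 * Num.min x (1 - x) <= sin (pi * x).
Proof.
have pi0 := @pi_gt0 R.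
have main (z : R) : 0 < z <= 2^-1 -> 2 * z <= sin (pi * z).
  move=> /andP[z0 z1]; rewrite -(ler_pM2l pi0) mulrCA; apply: jordan.
  by apply/andP; split; [rewrite mulr_ge0 ?ltW|rewrite ler_pM2l].
move=> /andP[x0 x1]; have [xh|xh] := leP x (1 - x); first by apply: main; lra.
have -> : sin (pi * x) = sin (pi * (1 - x)).
  by rewrite mulrBr mulr1 sinB sinpi cospi; lra.
by apply: main; lra.
Qed.

(** The largest of c+1 distinct positive integers is at least c+1; removing it leaves the case c. *)
Lemma sum_inv_injective (I : finType) (S : {set I}) (e : I -> nat) :
  {in S &, injective e} -> (forall i, i \in S -> (0 < e i)%N) ->
  \sum_(i in S) (e i)%:R^-1 <= \sum_(j < #|S|) (j.+1)%:R^-1 :> R.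
Proof.
move cS : #|S| => c; elim: c S cS => [|c IH] S cS inj e0.
  by move/eqP: cS; rewrite cards_eq0 => /eqP ->; rewrite big_set0 big_ord0.
have /card_gt0P[i1 i1S] : (0 < #|S|)%N by rewrite cS.
have [i0 i0S max0] := arg_maxnP e i1S.
have {}i0S : i0 \in S := i0S.
have cle : (c.+1 <= e i0)%N.
  rewrite -cS cardE -(size_map e) -[leqRHS](size_iota 1).
  apply: uniq_leq_size.
    by rewrite map_inj_in_uniq ?enum_uniq// => x y; rewrite !mem_enum; exact: inj.
  move=> x /mapP[k]; rewrite mem_enum => kS ->; rewrite mem_iota e0//= add1n ltnS.
  exact: max0.
rewrite (big_setD1 i0)//= big_ord_recr/= addrC; apply: lerD.
  apply: IH.
  - by apply/eqP; rewrite -eqSS -cS (cardsD1 i0 S) i0S.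
  - by move=> x y; rewrite !inE => /andP[_ ?] /andP[_ ?]; exact: inj.
  - by move=> x; rewrite !inE => /andP[_ ?]; exact: e0.
by rewrite lef_pV2 ?posrE ?ltr0n ?ler_nat// (leq_trans _ cle).
Qed.

Lemma harmonic_le_ln (r : nat) : (0 < r)%N -> \sum_(j < r) (j.+1)%:R^-1 <= 1 + ln r%:R :> R.
Proof.
case: r => // r _; elim: r => [|r IH]; first by rewrite big_ord1 invr1 ln1 addr0.
rewrite big_ord_recr/=; apply: le_trans (lerD IH (lexx _)) _.
rewrite -addrA lerD2l; set a : R := r.+1%:R.
have a0 : 0 < a by rewrite ltr0n.
have b0 : 0 < r.+2%:R :> R by rewrite ltr0n.
have -> : ln a = ln r.+2%:R + ln (1 + - r.+2%:R^-1).
  rewrite -lnM ?posrE//.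
    congr ln; rewrite mulrDr mulr1 mulrN mulfV ?gt_eqF//.
    by apply/esym; rewrite -natr1 addrK.
  by rewrite subr_gt0 invf_lt1// ltr1n.
rewrite -addrA gerDl -lerBrDr sub0r.
by apply: le_ln1Dx; rewrite ltrN2 invf_lt1// ltr1n.
Qed.

(** A fractional knapsack: S carries the r largest values of P. The mass of C outside S is at most
    the slack r c minus the mass inside, and moving it onto S, where P is nowhere smaller, does not
    decrease the sum. *)
Lemma sum_le_top (I : finType) (C P : I -> R) (r : nat) (c : R) :
  (forall i, 0 <= C i <= c) -> (forall i, 0 <= P i) -> (r <= #|I|)%N ->
  \sum_i C i <= r%:R * c ->
  exists2 S : {set I}, #|S| = r & \sum_i C i * P i <= c * \sum_(i in S) P i.
Proof.
move=> C01 P0 rI sC.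
have [S0 cS0] : exists S : {set I}, #|S| == r.
  exists [set i in take r (enum I)].
  rewrite cardsE (card_uniqP _) ?take_uniq ?enum_uniq// size_takel// -cardE//.
case: (@Order.TotalTheory.arg_maxP _ _ _ S0 (fun S : {set I} => #|S| == r)
  (fun S : {set I} => \sum_(i in S) P i) cS0) => S /eqP cS maxS.
exists S => //.
have swap i j : i \in S -> j \notin S -> P j <= P i.
  move=> iS jS; have := maxS (j |: (S :\ i)).
  rewrite cardsU1 !inE (negbTE jS) andbF add1n.
  have -> : #|S :\ i|.+1 = r by rewrite -cS (cardsD1 i S) iS.
  rewrite eqxx => /(_ isT); rewrite big_setU1/=; last by rewrite !inE (negbTE jS) andbF.
  by rewrite (big_setD1 i iS)/= lerD2r.
case: (posnP r) => [r0|r0].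
  have C0 i : C i = 0.
    apply/eqP; rewrite eq_le (andP (C01 i)).1 andbT.
    apply: le_trans (_ : \sum_i C i <= 0); last by move: sC; rewrite r0 mul0r.
    by rewrite (bigD1 i)//= lerDl; apply: sumr_ge0 => j _; case/andP: (C01 j).
  rewrite big1; last by move=> i _; rewrite C0 mul0r.
  by move/eqP: cS; rewrite r0 cards_eq0 => /eqP ->; rewrite big_set0 mulr0.
have /card_gt0P[i1 i1S] : (0 < #|S|)%N by rewrite cS.
case: (@Order.TotalTheory.arg_minP _ _ _ i1 (fun i => i \in S) P i1S) => i2 i2S min2.
rewrite (bigID (fun i => i \in S))/=.
apply: (@le_trans _ _ (\sum_(i in S) C i * P i + P i2 * \sum_(i | i \notin S) C i)).
  rewrite lerD2l mulr_sumr; apply: ler_sum => j jS; rewrite mulrC.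
  by apply: ler_wpM2r; [case/andP: (C01 j)|exact: swap].
apply: (@le_trans _ _ (\sum_(i in S) C i * P i + P i2 * \sum_(i in S) (c - C i))).
  rewrite lerD2l; apply: ler_wpM2l => //.
  rewrite sumrB sumr_const cS -[c *+ r]mulr_natl.
  by move: sC; rewrite (bigID (fun i => i \in S))/=; lra.
rewrite mulr_sumr -big_split/= mulr_sumr; apply: ler_sum => i iS.
have : P i2 * (c - C i) <= P i * (c - C i).
  by apply: ler_wpM2r; [have /andP[] := C01 i; lra|exact: min2].
lra.
Qed.

End elementary_bounds.

(** * Odd frequencies from even ones by the Dirichlet kernel *)

Section interpolation.
Context {R : realType}.
Local Notation C := R[i].
Local Notation normc := Normc.normc.

Lemma ew_double N j : ew (2 * N) (2 * j) = ew N j :> C.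
Proof.
case: (posnP N) => [->|N0]; first by rewrite /ew !invr0 !mulr0.
rewrite /ew; congr expi; rewrite natrM intrM; field.
by rewrite pnatr_eq0 -lt0n.
Qed.

Lemma ord_subE p (k l : 'I_p.+1) :
  val (k - l) = if (l <= k)%N then (k - l)%N else (k + p.+1 - l)%N.
Proof.
have := ltn_ord k; have := ltn_ord l => lp kp.
rewrite /=; case: ifP => lk.
  case: (posnP l) => [->|l0]; first by rewrite subn0 modnn addn0 modn_small ?subn0.
  rewrite (@modn_small (p.+1 - l)); last by lia.
  by rewrite (_ : (k + (p.+1 - l) = (k - l) + p.+1)%N) ?modnDr ?modn_small//; lia.
rewrite (@modn_small (p.+1 - l)); last by lia.
by rewrite modn_small; lia.
Qed.

(* Bounds the normalized Dirichlet kernel at the odd frequency 2e+1 of the circle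
   of length 2N. *)
Definition kap (N e : nat) : R := (e.*2.+1)%:R^-1 + (2 * N - e.*2.+1)%:R^-1.

(** A geometric sum: the numerator is at most 2, and with x = o / M the denominator 2 sin (pi x) is
    at least 4 min (x, 1 - x). The sum of the two reciprocals replaces the larger one. *)
Lemma dirichlet_le (m o : nat) : (0 < o < 2 * (2 * m).+1)%N ->
  normc (symsum m (fun t => ew (2 * (2 * m).+1) (- (o%:Z * t)))) <=
  (2 * m).+1%:R * (o%:R^-1 + (2 * (2 * m).+1 - o)%:R^-1) :> R.
Proof.
set N := (2 * m).+1; set M := (2 * N)%N.
move=> /andP [].
move=> o0 oM.
have MR : (0 : R) < M%:R by rewrite ltr0n /M; lia.
have oR : (0 : R) < o%:R by rewrite ltr0n.
have oMR : (o%:R : R) < M%:R by rewrite ltr_nat.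
pose q : C := ew M (- o%:Z).
have -> : symsum m (fun t => ew M (- (o%:Z * t))) = ew M (o%:Z * m%:Z) * \sum_(i < N) q ^+ i.
  rewrite mulr_sumr; apply: eq_bigr => i _.
  by rewrite /q -ewX -ewD; congr ew; ring.
rewrite Normc.normcM normc_ew mul1r; set D := normc _.
have D0 : 0 <= D by exact: normc_ge0.
have h1 : D * normc (1 - q) <= 2.
  rewrite mulrC -Normc.normcM -opprB mulNr normcN -subrX1 -/N.
  apply: le_trans (le_normcD _ _) _.
  by rewrite normcN Normc.normc1 /q -ewX normc_ew.
have x01 : 0 < (o%:R / M%:R : R) < 1.
  by rewrite divr_gt0//= ltr_pdivrMr ?mul1r.
have h2 : normc (1 - q) = 2 * sin (pi * (o%:R / M%:R)).
  rewrite /q /ew normc_1Bexpi; congr (_ * _).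
  have -> : 2 * pi * (- o%:Z)%:~R / M%:R / 2 = - (pi * (o%:R / M%:R)) :> R.
    by rewrite mulrNz -pmulrn; field; rewrite gt_eqF.
  rewrite sinN normrN ger0_norm//; apply: sin_ge0_pi.
  have /andP[a b] := x01; have p0 := @pi_gt0 R.
  by apply/andP; split; [rewrite mulr_ge0 ?ltW|rewrite ger_pMr ?ltW].
have h3 := sin_pi_ge x01.
set x := o%:R / M%:R in x01 h2 h3.
have xm : 0 < Num.min x (1 - x) by rewrite lt_min; lra.
have h4 : D * (2 * Num.min x (1 - x)) <= 1.
  have : D * (2 * Num.min x (1 - x)) <= D * sin (pi * x) by apply: ler_wpM2l.
  by rewrite h2 in h1; lra.
have e1 : N%:R * o%:R^-1 = (2 * x)^-1 :> R.
  by rewrite /x /M natrM; field; rewrite !gt_eqF ?ltr0n.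
have e2 : N%:R * (M - o)%:R^-1 = (2 * (1 - x))^-1 :> R.
  rewrite natrB ?(ltnW oM)// /x /M natrM; field.
  rewrite pnatr_eq0 /= subr_eq0 gt_eqF//.
  by rewrite -natrM.
rewrite mulrDr e1 e2; move: h4 xm.
have x0 : 0 < (2 * x)^-1 by rewrite invr_gt0; lra.
have x1 : 0 < (2 * (1 - x))^-1 by rewrite invr_gt0; lra.
case: (leP x (1 - x)) => _ h4 xm.
  have : D <= (2 * x)^-1 by rewrite -[leRHS]mul1r ler_pdivlMr//; lra.
  lra.
have : D <= (2 * (1 - x))^-1 by rewrite -[leRHS]mul1r ler_pdivlMr//; lra.
lra.
Qed.

(** The even frequencies are a full Fourier transform of length 2m+1, which determines [phi] on its
    window ([inv]); inserting this inversion at an odd frequency produces the kernel at the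
    frequency difference. *)
Lemma dtft_odd_le m (phi : cseq R) (k : 'I_(2 * m).+1) :
  normc (dtft (2 * (2 * m).+1) m phi k.*2.+1) <=
  \sum_(l < (2 * m).+1) normc (dtft (2 * (2 * m).+1) m phi l.*2) *
    kap (2 * m).+1 (val (k - l)).
Proof.
set N := (2 * m).+1; set M := (2 * N)%N.
have N0 : (0 : R) < N%:R by rewrite ltr0n.
have inv t : (`|t| <= m%:Z)%R ->
    N%:R * phi t = \sum_(l < N) dtft M m phi l.*2 * ew M (l.*2%:Z * t).
  move=> tm; rewrite -(symsum_delta phi tm) /symsum mulr_sumr.
  under [RHS]eq_bigr => l _ do rewrite /dtft /symsum mulr_suml.
  rewrite exchange_big/=; apply: eq_bigr => i _; set r := i%:Z - _.
  have rm : (`|r| <= m%:Z)%R by rewrite /r; have := ltn_ord i; lia.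
  under eq_bigr => l _.
    rewrite -mulrA -ewD (_ : _ + _ = 2 * ((t - r) * l%:Z)); last first.
      by rewrite -muln2; lia.
    rewrite ew_double.
    over.
  rewrite -mulr_sumr sum_ew//; last by rewrite /N; lia.
  rewrite subr_eq0 (eq_sym t); case: eqP => _; last by rewrite !mulr0n !mulr0.
  by rewrite !mulr1n mulrC.
pose e (l : 'I_N) := val (k - l).
have key : N%:R * dtft M m phi k.*2.+1 = \sum_(l < N) dtft M m phi l.*2 *
    symsum m (fun t => ew M (- ((e l).*2.+1%:Z * t))).
  rewrite {1}/dtft /symsum mulr_sumr.
  under [RHS]eq_bigr => l _ do rewrite mulr_sumr.
  rewrite exchange_big/=; apply: eq_bigr => i _; set t := i%:Z - _.
  have tm : (`|t| <= m%:Z)%R by rewrite /t; have := ltn_ord i; lia.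
  rewrite mulrA inv// mulr_suml; apply: eq_bigr => l _; rewrite -mulrA -ewD.
  congr (_ * _); rewrite /e ord_subE.
  have := ltn_ord l; have := ltn_ord k => kN lN.
  have dblE (a b : nat) : (b <= a)%N -> ((a - b)%N.*2.+1)%:Z = 2 * a%:Z - 2 * b%:Z + 1.
    by move=> ba; rewrite -muln2; lia.
  have dbl0 (a : nat) : a.*2%:Z = 2 * a%:Z by rewrite -muln2; lia.
  have dbl1 (a : nat) : a.*2.+1%:Z = 2 * a%:Z + 1 by rewrite -muln2; lia.
  rewrite dbl0 dbl1; case: ifP => lk; first by rewrite dblE//; congr ew; ring.
  have lk' : (l <= k + (2 * m).+1)%N by apply: leq_trans (ltnW lN) _; rewrite leq_addl.
  rewrite dblE// PoszD.
  (* When k < l, the subtraction of ordinals adds 2m+1 to k - l, which shifts the frequency by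
     exactly one period M. *)
  rewrite [LHS](_ : _ = ew M (2 * l%:Z * t + - ((2 * k%:Z + 1) * t) - M%:Z * t) * ew M (M%:Z * t)).
    by rewrite ew_period// mulr1; congr ew; rewrite /M /N PoszM; ring.
  by rewrite -ewD; congr ew; ring.
rewrite -(ler_pM2l N0).
have -> : N%:R * normc (dtft M m phi k.*2.+1) = normc (N%:R * dtft M m phi k.*2.+1).
  by rewrite Normc.normcM -(rmorph_nat (real_complex R)) normc_real ger0_norm// ltW.
rewrite key; apply: le_trans (ler_normc_sum _ _ _) _; rewrite -/e.
rewrite mulr_sumr; apply: ler_sum => l _.
rewrite Normc.normcM mulrCA; apply: ler_wpM2l; first exact: normc_ge0.
have : (e l < N)%N := ltn_ord (k - l).
rewrite -/(e l) => eN; apply: dirichlet_le; rewrite -muln2; move: eN; rewrite /N; lia.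
Qed.

End interpolation.

(** * Weights of frequency sets and domination of feasible responses *)

Section weights.
Context {R : realType}.
Local Notation C := R[i].
Local Notation normc := Normc.normc.

Lemma sum_double (V : nmodType) (F : nat -> V) n :
  \sum_(f < 2 * n) F f = \sum_(k < n) (F k.*2 + F k.*2.+1).
Proof.
elim: n => [|n IH]; first by rewrite !big_ord0.
rewrite (_ : 2 * n.+1 = (2 * n).+2)%N; last by lia.
by rewrite !big_ord_recr/= IH addrA mul2n.
Qed.

Lemma kap_ge0 N e : 0 <= kap N e :> R.
Proof. by rewrite addr_ge0. Qed.

(** The odd numbers 2e+1 are distinct as e varies, and so are their complements 2N - (2e+1); each
    half of the kernel is thus below a harmonic sum with [#|S|] terms. The logarithm sees the size
    of S, not N. *)
Lemma sum_kap_le p (S : {set 'I_p.+1}) (g : 'I_p.+1 -> 'I_p.+1) :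
  injective g -> (0 < #|S|)%N ->
  \sum_(l in S) kap p.+1 (val (g l)) <= 2 * (1 + ln #|S|%:R) :> R.
Proof.
move=> ginj S0; rewrite /kap big_split/= mulrDl mul1r.
have h : \sum_(j < #|S|) j.+1%:R^-1 <= 1 + ln #|S|%:R :> R by exact: harmonic_le_ln.
apply: lerD; apply: le_trans h.
  apply: (sum_inv_injective (e := fun l => (val (g l)).*2.+1)) => [x y _ _|//].
  by move=> /eqP; rewrite eqSS => /eqP /double_inj /val_inj /ginj.
apply: (sum_inv_injective (e := fun l => (2 * p.+1 - (val (g l)).*2.+1)%N)).
  move=> x y _ _ h'; apply: ginj; apply: val_inj; move: h' => /=.
  by have := ltn_ord (g x); have := ltn_ord (g y); rewrite -!muln2; lia.
by move=> i _; have := ltn_ord (g i); rewrite -!muln2 /=; lia.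
Qed.

(* On the circle of length 2(2m+1) the even frequencies are the Fourier
   frequencies of the filter, and the odd ones are interpolated from them. *)
Definition wt m (S : {set 'I_(2 * m).+1}) (f : nat) : R :=
  if odd f then \sum_(l in S) kap (2 * m).+1 (val (inord f./2 - l))
  else (inord f./2 \in S)%:R.

Lemma wt_double m (S : {set 'I_(2 * m).+1}) (k : 'I_(2 * m).+1) :
  wt S k.*2 = (k \in S)%:R.
Proof. by rewrite /wt odd_double doubleK inord_val. Qed.

Lemma wt_doubleS m (S : {set 'I_(2 * m).+1}) (k : 'I_(2 * m).+1) :
  wt S k.*2.+1 = \sum_(l in S) kap (2 * m).+1 (val (k - l)).
Proof. by rewrite /wt /= odd_double /= uphalf_double inord_val. Qed.

Lemma wt_ge0 m (S : {set 'I_(2 * m).+1}) f : 0 <= wt S f.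
Proof.
by rewrite /wt; case: ifP => _; [apply: sumr_ge0 => l _; exact: kap_ge0|].
Qed.

Lemma wt_le m (S : {set 'I_(2 * m).+1}) f : (0 < #|S|)%N ->
  wt S f <= 2 * (1 + ln #|S|%:R).
Proof.
move=> S0; rewrite /wt; case: ifP => _.
  by apply: (sum_kap_le (g := fun l => inord f./2 - l)) => //; exact: subrI.
have : 0 <= ln #|S|%:R :> R by rewrite ln_ge0// ler1n.
by case: (_ \in _) => /=; lra.
Qed.

(** Each l in S counts 1 at its own even frequency and at most 2 (1 + ln (2m+1)) over all odd
    ones. *)
Lemma sum_wt_le m (S : {set 'I_(2 * m).+1}) :
  \sum_(f < 2 * (2 * m).+1) wt S f <= #|S|%:R * (3 + 2 * ln (2 * m).+1%:R).
Proof.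
rewrite sum_double.
under eq_bigr do rewrite wt_double wt_doubleS.
rewrite big_split/= exchange_big/= [in leRHS]mulrC.
have -> : \sum_(i < (2 * m).+1) (i \in S)%:R = #|S|%:R :> R.
  by rewrite -natr_sum -sum1_card [in RHS]big_mkcond; congr (_%:R); apply: eq_bigr => i _; case: (i \in S).
have -> : (3 + 2 * ln (2 * m).+1%:R) * #|S|%:R =
   #|S|%:R + \sum_(l in S) (2 * (1 + ln (2 * m).+1%:R)) :> R.
  by rewrite sumr_const -[_ *+ #|S|]mulr_natr; ring.
rewrite lerD2l; apply: ler_sum => l _.
have h := @sum_kap_le _ [set: 'I_(2 * m).+1]%SET (fun k => k - l) (addIr _).
rewrite cardsT card_ord in h; apply: le_trans (h isT).
by rewrite le_eqVlt; apply/orP; left; apply/eqP; apply: eq_bigl => k; rewrite finset.in_setT.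
Qed.

Lemma dtft_double m (phi : cseq R) (k : nat) :
  normc (dtft (2 * (2 * m).+1) m phi k.*2) =
  Num.sqrt (2 * m).+1%:R * normc (dft m phi k).
Proof.
have N0 : (0 : R) < (2 * m).+1%:R by rewrite ltr0n.
rewrite /dft Normc.normcM normc_real ger0_norm ?invr_ge0 ?sqrtr_ge0//.
rewrite mulVKf ?gt_eqF ?sqrtr_gt0//; congr normc; apply: eq_bigr => i _.
rewrite mulrC; congr (_ * _).
have -> : - (k.*2%:Z * (i%:Z - m%:Z)) = 2 * - (k%:Z * (i%:Z - m%:Z)).
  by rewrite -muln2 PoszM; ring.
rewrite ew_double /ew; congr expi; rewrite mulrNz intrM -pmulrn.
by rewrite mulrN mulNr !mulrA.
Qed.

Lemma c_star_ge14 : 14 <= c_star R.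
Proof.
have := @pi_ge2 R; rewrite /c_star => h.
have : (2 : R) ^+ 2 <= pi ^+ 2 by rewrite ler_sqr ?nnegrE ?pi_ge0.
by lra.
Qed.

Lemma feasible_bounds s m (phi : cseq R) : (0 < s)%N -> feasible s m phi ->
  (forall k : 'I_(2 * m).+1, normc (dtft (2 * (2 * m).+1) m phi k.*2) <= c_star R) /\
  \sum_(k < (2 * m).+1) normc (dtft (2 * (2 * m).+1) m phi k.*2) <=
    (18 * s)%:R * c_star R.
Proof.
move=> s0 [_]; have N0 : (0 : R) < Num.sqrt (2 * m).+1%:R by rewrite sqrtr_gt0 ltr0n.
have s0R : (0 : R) < s%:R by rewrite ltr0n.
rewrite ge_max => /andP[h1 h2]; split.
  move=> k; rewrite dtft_double mulrC -ler_pdivlMr//.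
  have hk : normc (dft m phi k) <= dft_linf m phi by exact: (le_bigmax _ (fun k : 'I__ => normc (dft m phi k))).
  apply: le_trans hk _.
  have : 18 * s%:R * dft_linf m phi <= 18 * s%:R * (c_star R / Num.sqrt (2 * m).+1%:R).
    by apply: le_trans h2 _; rewrite le_eqVlt; apply/orP; left; apply/eqP; ring.
  by rewrite ler_pM2l// mulr_gt0.
under eq_bigr do rewrite dtft_double.
rewrite -mulr_sumr mulrC -ler_pdivlMr//; apply: le_trans h1 _.
by rewrite natrM le_eqVlt; apply/orP; left; apply/eqP; ring.
Qed.

Lemma feasible_dominated s m (phi : cseq R) (q : nat -> R) (b : R) :
  (0 < s)%N -> (18 * s <= (2 * m).+1)%N -> feasible s m phi ->
  (forall f, 0 <= q f) ->
  (forall S : {set 'I_(2 * m).+1}, #|S| = (18 * s)%N ->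
     \sum_(f < 2 * (2 * m).+1) wt S f * q f <= b) ->
  \sum_(f < 2 * (2 * m).+1) normc (dtft (2 * (2 * m).+1) m phi f) * q f <= c_star R * b.
Proof.
move=> s0 sm feas q0 H; have [c1 c2] := feasible_bounds s0 feas.
set Phi := dtft (2 * (2 * m).+1) m phi in c1 c2 *.
(* [Q l] collects what the even frequency l contributes both directly and through every odd
   frequency, so the bound is linear in the even response alone and [sum_le_top] applies. *)
pose Q (l : 'I_(2 * m).+1) := q l.*2 + \sum_(k < (2 * m).+1) kap (2 * m).+1 (val (k - l)) * q k.*2.+1.
have Q0 l : 0 <= Q l.
  by rewrite addr_ge0// sumr_ge0// => k _; rewrite mulr_ge0 ?kap_ge0.
have C01 (l : 'I_(2 * m).+1) : 0 <= normc (Phi l.*2) <= c_star R by rewrite normc_ge0 c1.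
have sI : (18 * s <= #|'I_(2 * m).+1|)%N by rewrite card_ord.
have [S cS hS] := sum_le_top C01 Q0 sI c2.
have QS : \sum_(l in S) Q l = \sum_(f < 2 * (2 * m).+1) wt S f * q f.
  rewrite (sum_double (fun f => wt S f * q f)) [RHS]big_split/= /Q big_split/=; congr (_ + _).
    rewrite [LHS]big_mkcond; apply: eq_bigr => k _; rewrite wt_double.
    by case: (k \in S); rewrite ?mul1r ?mul0r.
  rewrite exchange_big/=; apply: eq_bigr => k _; rewrite wt_doubleS mulr_suml.
  by apply: eq_bigr.
apply: (@le_trans _ _ (c_star R * \sum_(l in S) Q l)); last first.
  by rewrite QS ler_wpM2l ?H//; have := c_star_ge14; lra.
apply: le_trans hS; rewrite (sum_double (fun f => normc (Phi f) * q f)).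
rewrite /Q; under [leRHS]eq_bigr do rewrite mulrDr.
rewrite !big_split/= lerD2l.
under [leRHS]eq_bigr do rewrite mulr_sumr.
rewrite exchange_big/=; apply: ler_sum => k _.
apply: (@le_trans _ _ ((\sum_(l < (2 * m).+1) normc (Phi l.*2) * kap (2 * m).+1 (val (k - l))) * q k.*2.+1)).
  by apply: ler_wpM2r => //; exact: dtft_odd_le.
by rewrite mulr_suml; apply: ler_sum => l _; rewrite mulrA.
Qed.

End weights.

(** * The averaged projector as a reproducing feasible filter *)

Section oracle_filter.
Context {R : realType}.
Local Notation C := R[i].
Local Notation normc := Normc.normc.

Lemma iter_Delta (x : cseq R) i t : iter i (@Delta R) x t = x (t - i%:Z).
Proof.
elim: i t => [|i IH] t; first by rewrite subr0.
by rewrite iterS /Delta IH; congr x; rewrite intS; ring.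
Qed.

Lemma Xs_recurrence s (x : cseq R) : Xs s x ->
  exists a : nat -> C, forall t, x t = \sum_(i < s) a i * x (t - 1 - i%:Z).
Proof.
move=> [w fx]; set f := \prod_(k < s) _ in fx.
have f0 : f`_0 = 1.
  rewrite -horner_coef0 /f horner_prod big1// => k _.
  by rewrite !hornerE ?mulr0 ?subr0.
have szf : (size f <= s.+1)%N.
  apply: leq_trans (size_prod_leq _ _) _.
  rewrite leq_subLR cardE enumT -enumT -cardE card_ord.
  have : (\sum_(i < s) size (1 - (w i)%:P * 'X : {poly C})%R <= \sum_(i < s) 2)%N.
    apply: leq_sum => i _; apply: leq_trans (size_polyD _ _) _.
    rewrite geq_max size_poly1 size_polyN/=.
    by apply: leq_trans (size_polyMleq _ _) _; rewrite size_polyX size_polyC; case: eqP.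
  by move=> /leq_ltn_trans; apply; rewrite sum_nat_const card_ord; lia.
exists (fun i => - f`_i.+1) => t.
have := congr1 (fun u : cseq R => u t) fx; rewrite /poly_Delta.
rewrite (big_ord_widen _ (fun i => f`_i * iter i (@Delta R) x t) szf).
rewrite big_mkcond/= big_ord_recl/= f0 => h.
have {}h : x t + \sum_(i < s) f`_i.+1 * x (t - 1 - i%:Z) = 0.
  rewrite -[RHS]h; congr (_ + _).
    rewrite mul1r; case: posnP => // /eqP; rewrite size_poly_eq0 => /eqP f00.
    by move: f0; rewrite f00 coef0 => /eqP; rewrite eq_sym oner_eq0.
  apply: eq_bigr => i _; rewrite /bump/= add1n.
  case: ltnP => si; last by rewrite (nth_default _ si) mul0r.
  by rewrite -[Delta _]/(iter i.+1 (@Delta R) x) iter_Delta; congr (_ * x _); rewrite intS; ring.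
move/eqP: h; rewrite addr_eq0 => /eqP ->; rewrite -sumrN.
by apply: eq_bigr => i _; rewrite mulNr.
Qed.

(** The coefficients v do not depend on the position c; this shift invariance lets one projector
    serve all windows. *)
Lemma Xs_window_span s (x : cseq R) (j : nat) : Xs s x ->
  exists v : 'cV[C]_s, forall c : int,
    x (c + j%:Z) = \sum_(i < s) x (c + i%:Z) * v i 0.
Proof.
move=> /Xs_recurrence[a Hx].
elim/ltn_ind: j => j IH.
case: (ltnP j s) => js.
  exists (delta_mx (Ordinal js) 0) => c.
  rewrite (bigD1 (Ordinal js))//= mxE !eqxx mulr1 big1 ?addr0// => i ij.
  by rewrite mxE (negbTE ij) mulr0.
have /choice[v Hv] : forall i : 'I_s, exists v : 'cV[C]_s, forall c : int,
    x (c + (j - i.+1)%N%:Z) = \sum_(i < s) x (c + i%:Z) * v i 0.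
  by move=> i; apply: IH; have := ltn_ord i; lia.
exists (\sum_(i < s) a i *: v i) => c.
rewrite Hx.
transitivity (\sum_(i < s) a i * \sum_(k < s) x (c + k%:Z) * v i k 0).
  apply: eq_bigr => i _; rewrite -Hv; congr (_ * x _).
  by have := ltn_ord i; lia.
under eq_bigr do rewrite mulr_sumr.
rewrite exchange_big/=; apply: eq_bigr => k _.
rewrite summxE mulr_sumr; apply: eq_bigr => i _.
by rewrite mxE mulrCA.
Qed.

(** All windows lie in the row space of an s by L matrix [E], which may be rank deficient; Schmidt
    orthonormalization still returns s orthonormal rows whose span contains that space, which is why
    s <= L is required. *)
Lemma Xs_window_projector s L (x : cseq R) : Xs s x -> (s <= L)%N ->
  exists2 U : 'M[C]_(s, L),
    (forall i j, \sum_(a < L) U i a * conjc (U j a) = (i == j)%:R) &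
    forall (c : int) (a : 'I_L),
      x (c + a%:Z) = \sum_(b < L) x (c + b%:Z) * \sum_(i < s) conjc (U i b) * U i a.
Proof.
move=> xX sL.
have /choice[v Hv] : forall j : 'I_L, exists v : 'cV[C]_s, forall c : int,
    x (c + j%:Z) = \sum_(i < s) x (c + i%:Z) * v i 0 by move=> j; exact: Xs_window_span.
pose E : 'M[C]_(s, L) := \matrix_(i, j) v j i 0.
pose U := schmidt E.
have /unitarymxP UU : U \is unitarymx by exact: schmidt_unitarymx.
have EU : (E <= U)%MS by exact: schmidt_sub.
exists U => [i j|c a].
  have := congr1 (fun A : 'M[C]_s => A i j) UU; rewrite !mxE => <-.
  by apply: eq_bigr => k _; rewrite !mxE.
pose w : 'rV[C]_L := \row_b x (c + b%:Z).
have wE : (w <= E)%MS.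
  apply/submxP; exists (\row_i x (c + i%:Z)); apply/rowP => b.
  by rewrite !mxE Hv; apply: eq_bigr => i _; rewrite !mxE.
have /submxP[D wD] : (w <= U)%MS by exact: submx_trans EU.
have wP : w = w *m map_mx Num.conj U^T *m U by rewrite {2}wD -!mulmxA (mulmxA U) UU mul1mx.
have := congr1 (fun A : 'rV[C]_L => A 0 a) wP; rewrite [in LHS]mxE => ->.
rewrite mxE; under eq_bigr do rewrite mxE mulr_suml.
rewrite exchange_big/=; apply: eq_bigr => b _; rewrite mulr_sumr.
by apply: eq_bigr => i _; rewrite !mxE mulrA.
Qed.

Lemma bessel_rows s L (U : 'M[C]_(s, L)) (e : 'I_L -> C) :
  (forall i j, \sum_(a < L) U i a * conjc (U j a) = (i == j)%:R) ->
  \sum_(i < s) normc (\sum_(a < L) U i a * e a) ^+ 2 <= \sum_(a < L) normc (e a) ^+ 2.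
Proof.
move=> UU; pose v i := \sum_(a < L) U i a * e a.
(* [g] is the orthogonal projection of [e]; since <e, g> = <g, g>, the square of e - g expands to
   the claimed difference. *)
pose g a := \sum_(i < s) conjc (U i a) * v i.
have eg : \sum_a e a * conjc (g a) = \sum_i v i * conjc (v i).
  rewrite /g; under eq_bigr do rewrite conjc_sum mulr_sumr.
  rewrite exchange_big/=; apply: eq_bigr => i _.
  rewrite {1}/v mulr_suml; apply: eq_bigr => a _.
  by rewrite conjcM conjcK; ring.
have gg : \sum_a g a * conjc (g a) = \sum_i v i * conjc (v i).
  rewrite {2}/g; under eq_bigr do rewrite conjc_sum mulr_sumr.
  rewrite exchange_big/=; apply: eq_bigr => i _.
  transitivity ((\sum_a U i a * g a) * conjc (v i)).
    by rewrite mulr_suml; apply: eq_bigr => a _; rewrite conjcM conjcK; ring.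
  congr (_ * _); rewrite /g; under eq_bigr do rewrite mulr_sumr.
  rewrite exchange_big/= (bigD1 i)//= [X in _ + X]big1 ?addr0.
    under eq_bigr do rewrite mulrA.
    by rewrite -mulr_suml UU eqxx mul1r.
  move=> j ji; under eq_bigr do rewrite mulrA.
  by rewrite -mulr_suml UU eq_sym (negbTE ji) mul0r.
have sE (I : finType) (F : I -> C) : \sum_i normc (F i) ^+ 2 = complex.Re (\sum_i F i * conjc (F i)).
  by rewrite complex_Re_sum; apply: eq_bigr => i _; rewrite -normc_sqr_conj.
have : 0 <= \sum_a normc (e a - g a) ^+ 2 by apply: sumr_ge0 => a _; exact: sqr_ge0.
have -> : \sum_a normc (e a - g a) ^+ 2 =
    \sum_a normc (e a) ^+ 2 - \sum_i normc (v i) ^+ 2.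
  transitivity (\sum_a normc (e a) ^+ 2 + \sum_a normc (g a) ^+ 2
      - 2 * complex.Re (\sum_a e a * conjc (g a))).
    rewrite complex_Re_sum mulr_sumr -big_split/= -sumrB; apply: eq_bigr => a _.
    rewrite !normc_sqrE; case: (e a) => ? ?; case: (g a) => ? ? /=; ring.
  by rewrite eg (sE _ g) gg -(sE _ v); ring.
by rewrite subr_ge0.
Qed.

Section autocorrelation.
Variables (s p : nat) (U : 'M[C]_(s, p.+1)).
Hypothesis UU : forall i j, \sum_(a < p.+1) U i a * conjc (U j a) = (i == j)%:R.

(* The average over the window of the projector onto the row space of U. *)
Definition autocorr : cseq R := fun t =>
  (p.+1%:R)^-1 * \sum_(a < p.+1) \sum_(b < p.+1)
    (\sum_(i < s) conjc (U i b) * U i a) *+ (a%:Z - b%:Z == t).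

Lemma autocorr_supported : supported p autocorr.
Proof.
move=> t pt; rewrite /autocorr big1 ?mulr0// => a _; rewrite big1// => b _.
rewrite (_ : (_ == t) = false)//; apply/negP => /eqP h.
by have := ltn_ord a; have := ltn_ord b; lia.
Qed.

Lemma symsum_autocorr (F : int -> C) :
  symsum p (fun t => autocorr t * F t) =
  (p.+1%:R)^-1 * \sum_(a < p.+1) \sum_(b < p.+1)
    (\sum_(i < s) conjc (U i b) * U i a) * F (a%:Z - b%:Z).
Proof.
rewrite /symsum /autocorr.
under eq_bigr => t _ do rewrite -mulrA mulr_suml.
rewrite -mulr_sumr exchange_big/=; congr (_ * _); apply: eq_bigr => a _.
under eq_bigr => t _ do rewrite mulr_suml.
rewrite exchange_big/=; apply: eq_bigr => b _.
have ab : (`|a%:Z - b%:Z| <= p%:Z)%R by have := ltn_ord a; have := ltn_ord b; lia.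
rewrite -(symsum_delta F ab) /symsum mulr_sumr; apply: eq_bigr => i _.
by rewrite eq_sym; case: eqP; rewrite ?mulr1n ?mulr0n ?mul0r ?mulr0.
Qed.

Lemma autocorr_reproduces (x : cseq R) (t : int) :
  (forall (c : int) (a : 'I_p.+1),
      x (c + a%:Z) = \sum_(b < p.+1) x (c + b%:Z) * \sum_(i < s) conjc (U i b) * U i a) ->
  Defs.conv p autocorr x t = x t.
Proof.
move=> Hx; rewrite /Defs.conv (symsum_autocorr (fun tau => x (t - tau))).
transitivity ((p.+1%:R)^-1 * \sum_(a < p.+1) x t).
  congr (_ * _); apply: eq_bigr => a _.
  have {2}-> : t = (t - a%:Z) + a%:Z by rewrite subrK.
  rewrite Hx; apply: eq_bigr => b _; rewrite mulrC; congr (x _ * _).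
  by rewrite opprB addrA addrAC.
by rewrite sumr_const card_ord -[x t *+ _]mulr_natl mulKf// pnatr_eq0.
Qed.

Lemma dtft_autocorr M f :
  dtft M p autocorr f = ((p.+1%:R)^-1 *
    \sum_(i < s) normc (\sum_(a < p.+1) U i a * ew M (- (f%:Z * a%:Z))) ^+ 2)%:C%C.
Proof.
rewrite /dtft (symsum_autocorr (fun t => ew M (- (f%:Z * t)))).
rewrite rmorphM/= fmorphV rmorph_nat rmorph_sum; congr (_ * _).
under eq_bigr => a _ do under eq_bigr => b _ do rewrite mulr_suml.
under eq_bigr => a _ do rewrite exchange_big/=.
rewrite exchange_big/=; apply: eq_bigr => i _.
rewrite normc_sqr_conj conjc_sum mulr_suml; apply: eq_bigr => a _.
rewrite mulr_sumr; apply: eq_bigr => b _.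
rewrite conjcM conjc_ew opprK.
have -> : - (f%:Z * (a%:Z - b%:Z)) = - (f%:Z * a%:Z) + f%:Z * b%:Z by ring.
by rewrite ewD; ring.
Qed.

Lemma normc_dtft_autocorr_le1 M f : normc (dtft M p autocorr f) <= 1.
Proof.
rewrite dtft_autocorr normc_real ger0_norm; last first.
  by rewrite mulr_ge0// sumr_ge0// => i _; exact: sqr_ge0.
rewrite mulrC ler_pdivrMr ?ltr0n// mul1r.
apply: le_trans (bessel_rows _ UU) _.
under eq_bigr do rewrite normc_ew expr1n.
by rewrite sumr_const card_ord.
Qed.

(** Parseval applied to each of the s orthonormal rows gives s (2p+1) / (p+1). *)
Lemma sum_normc_dtft_autocorr :
  \sum_(k < (2 * p).+1) normc (dtft (2 * p).+1 p autocorr k) <= 2 * s%:R.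
Proof.
under eq_bigr => k _.
  rewrite dtft_autocorr normc_real ger0_norm; last first.
    by rewrite mulr_ge0// sumr_ge0// => i _; exact: sqr_ge0.
  over.
rewrite -mulr_sumr exchange_big/=.
have -> : \sum_(i < s) \sum_(k < (2 * p).+1)
    normc (\sum_(a < p.+1) U i a * ew (2 * p).+1 (- (k%:Z * a%:Z))) ^+ 2 = s%:R * (2 * p).+1%:R.
  rewrite -[s in s%:R * _]card_ord mulr_natl -sumr_const; apply: eq_bigr => i _.
  (* The row has p+1 entries; it is padded with zeros to the length 2p+1 of the circle. *)
  pose G a := if (a < p.+1)%N then conjc (U i (inord a)) else 0.
  have GE (V : nmodType) (F : nat -> C -> V) : (forall a, F a 0 = 0) ->
      \sum_(a < (2 * p).+1) F a (G a) = \sum_(a < p.+1) F a (conjc (U i a)).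
    move=> F0; have pp : (p.+1 <= (2 * p).+1)%N by lia.
    transitivity (\sum_(a < p.+1) F a (G a)).
      rewrite (big_ord_widen _ (fun a => F a (G a)) pp) [RHS]big_mkcond/=.
      by apply: eq_bigr => a _; rewrite {1}/G; case: ifP; rewrite ?F0// /G => ->.
    by apply: eq_bigr => a _; rewrite /G ltn_ord inord_val.
  transitivity (\sum_(k < (2 * p).+1) normc (\sum_(a < (2 * p).+1) G a * ew (2 * p).+1 (a%:Z * k%:Z)) ^+ 2).
    apply: eq_bigr => k _; congr (_ ^+ 2).
    rewrite (GE _ (fun a z => z * ew (2 * p).+1 (a%:Z * k%:Z))); last by move=> a; rewrite mul0r.
    rewrite -normc_conj conjc_sum; congr normc; apply: eq_bigr => a _.
    by rewrite conjcM conjc_ew opprK mulrC [in RHS]mulrC (mulrC a%:Z).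
  rewrite parseval// (GE _ (fun _ z => normc z ^+ 2)); last by move=> _; rewrite Normc.normc0 expr0n.
  rewrite -[RHS]mulr1; congr (_ * _).
  apply: complexI; rewrite rmorph_sum/= rmorph1.
  transitivity (\sum_(a < p.+1) U i a * conjc (U i a)); last by rewrite UU eqxx.
  by apply: eq_bigr => a _; rewrite normc_conj normc_sqr_conj.
rewrite mulrC ler_pdivrMr ?ltr0n//.
have : ((2 * p).+1%:R : R) <= 2 * p.+1%:R by rewrite -natrM ler_nat; lia.
have : (0 : R) <= s%:R by [].
nra.
Qed.

End autocorrelation.

(** The bounds 2s and 1 on the response lie well inside the constraints, as c_star >= 14. The bound
    1 is recorded at all frequencies because it later replaces a squared response by the
    response. *)
Lemma oracle_filter s p (x : cseq R) : Xs s x -> (0 < s)%N -> (s <= p.+1)%N ->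
  exists phi, [/\ feasible s p phi, forall t, Defs.conv p phi x t = x t &
    forall M f, normc (dtft M p phi f) <= 1].
Proof.
move=> xX s0 sp; have [U UU Hx] := Xs_window_projector xX sp.
exists (autocorr U); split; last 2 first.
- by move=> t; exact: autocorr_reproduces.
- by move=> M f; exact: normc_dtft_autocorr_le1.
split; first exact: autocorr_supported.
have N0 : (0 : R) < Num.sqrt (2 * p).+1%:R by rewrite sqrtr_gt0 ltr0n.
have s1 : (1 : R) <= s%:R by rewrite ler1n.
have c14 := @c_star_ge14 R.
have dE (k : nat) : normc (dft p (autocorr U) k) =
    normc (dtft (2 * p).+1 p (autocorr U) k) / Num.sqrt (2 * p).+1%:R.
  rewrite /dft Normc.normcM normc_real ger0_norm ?invr_ge0 ?sqrtr_ge0// mulrC.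
  congr (normc _ * _); apply: eq_bigr => i _; rewrite mulrC; congr (_ * _).
  rewrite /ew; congr expi; rewrite mulrNz intrM -pmulrn.
  by rewrite mulrN mulNr !mulrA.
rewrite ge_max ler_pdivlMr// ler_pdivlMr//; apply/andP; split.
  rewrite /dft_l1; under eq_bigr do rewrite dE.
  rewrite -mulr_suml divfK ?gt_eqF//; apply: le_trans (sum_normc_dtft_autocorr UU) _.
  nra.
have linf : dft_linf p (autocorr U) <= (Num.sqrt (2 * p).+1%:R)^-1.
  rewrite /dft_linf; apply: bigmax_le; first by rewrite invr_ge0 ltW.
  move=> k _; rewrite dE ler_pdivrMr// mulVf ?gt_eqF//.
  exact: normc_dtft_autocorr_le1.
have : 18 * s%:R * dft_linf p (autocorr U) * Num.sqrt (2 * p).+1%:R <=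
       18 * s%:R * (Num.sqrt (2 * p).+1%:R)^-1 * Num.sqrt (2 * p).+1%:R.
  by rewrite ler_pM2r// ler_wpM2l// mulr_ge0.
rewrite divfK ?gt_eqF// => h; apply: le_trans h _.
nra.
Qed.

End oracle_filter.

(** * Shifts of symmetric sums *)

Section symsum_reindex.
Context {R : realType}.
Local Notation C := R[i].
Local Notation normc := Normc.normc.

Lemma symsum_shift (V : nmodType) (K m : nat) (h : int) (F : int -> V) :
  (`|h| + m%:Z <= K%:Z)%R ->
  symsum m (fun s => F (s + h)) = symsum K (fun t => F t *+ (`|t - h| <= m%:Z)%R).
Proof.
move=> hK.
transitivity (symsum m (fun s => symsum K (fun t => F t *+ (t == s + h)))).
  by apply: eq_symsum => s sm; rewrite (symsum_delta F)//; lia.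
rewrite exchange_symsum; apply: eq_symsum => t tK.
have [tm|tm] := boolP (`|t - h| <= m%:Z)%R.
  rewrite -[RHS](symsum_delta (fun _ : int => F t) tm); apply: eq_symsum => s _.
  by congr (_ *+ _); congr nat_of_bool; apply/eqP/eqP; lia.
rewrite /symsum big1// => i _; rewrite (_ : (_ == _) = false)//.
by apply/negP => /eqP ti; move: tm; have := ltn_ord i; lia.
Qed.

Lemma ler_symsum p (F G : int -> R) :
  (forall t : int, (`|t| <= p%:Z)%R -> F t <= G t) -> symsum p F <= symsum p G.
Proof.
move=> FG; apply: ler_sum => i _; apply: FG.
by have := ltn_ord i; lia.
Qed.

Lemma bessel_opp M p (G : nat -> C) : (2 * p < M)%N ->
  symsum p (fun t => normc (\sum_(f < M) G f * ew M (- (f%:Z * t))) ^+ 2) <=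
  M%:R * \sum_(f < M) normc (G f) ^+ 2.
Proof.
move=> /(@bessel R M p (fun f => conjc (G f)) 0).
under [X in _ <= _ * X]eq_bigr do rewrite normc_conj.
apply: le_trans; rewrite le_eqVlt; apply/orP; left; apply/eqP/eq_symsum => t _.
rewrite -[in RHS]normc_conj conjc_sum; congr (normc _ ^+ 2); apply: eq_bigr => f _.
by rewrite conjcM conjcK conjc_ew addr0.
Qed.

End symsum_reindex.

(** * High-probability bounds for the quadratic forms of one block *)

Section gauss_events.
Context d (T : measurableType d) (R : realType) (P : probability T R).
Context (xi : int -> T -> R[i]) (K : nat).
Hypothesis xiP : iid_std_cgauss P xi K.
Local Notation normc := Normc.normc.

Let shifted (J : int -> bool) (h : int) (w : T) : cseq R :=
  window J (fun t => xi (t + h) w).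

Let dtft_coef (J : int -> bool) (h : int) (M m f : nat) (t : int) : R[i] :=
  (ew M (- (f%:Z * (t - h))) *+ J (t - h)) *+ (`|t - h| <= m%:Z)%R.

Let dtft_shifted J h M m f w : (`|h| + m%:Z <= K%:Z)%R ->
  dtft M m (shifted J h w) f = symsum K (fun t => dtft_coef J h M m f t * xi t w).
Proof.
move=> hK; rewrite /dtft /shifted /window.
rewrite -[LHS](@eq_symsum _ m (fun s => (fun t => (xi t w *+ J (t - h)) * ew M (- (f%:Z * (t - h)))) (s + h))); last first.
  by move=> t _; rewrite /= addrK.
rewrite (symsum_shift (fun t => (xi t w *+ J (t - h)) * ew M (- (f%:Z * (t - h)))) hK).
apply: eq_symsum => t _; rewrite /dtft_coef.
by case: (J _); case: (_ <= _); rewrite ?mulr1n ?mulr0n ?mul0r// mulrC.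
Qed.

Lemma measurable_dtft_form (J : int -> bool) (h : int) (M m : nat) (W : nat -> R) :
  (`|h| + m%:Z <= K%:Z)%R ->
  measurable_fun setT (fun w => \sum_(f < M)
    W f * normc (dtft M m (window J (fun t => xi (t + h) w)) f) ^+ 2).
Proof.
move=> hK; apply: measurable_sum => f.
under eq_fun do rewrite -/(shifted J h _) dtft_shifted//.
by apply: measurable_funM; [exact: measurable_cst|exact: (measurable_normc_lin xiP)].
Qed.

(** The square root of [W f / M] is moved into the linear forms; the condition of [iid_chaos_mgf]
    with [lam] equal to [W] is then Bessel's inequality on the circle of length M, and discarding
    points through [J] only lowers its left side. *)
Lemma dtft_form_mgf (J : int -> bool) (h : int) (M m : nat) (W : nat -> R) :
  (`|h| + m%:Z <= K%:Z)%R -> (2 * m < M)%N -> (forall f, 0 <= W f <= 2^-1) ->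
  (\int[P]_w (expR (\sum_(f < M)
     W f * (normc (dtft M m (window J (fun t => xi (t + h) w)) f) ^+ 2 / M%:R)))%:E
   <= (expR (2 * \sum_(f < M) W f))%:E)%E.
Proof.
move=> hK mM W01; have M0 : (0 : R) < M%:R by rewrite ltr0n; lia.
pose c f := Num.sqrt (W f / M%:R).
have c2 f : c f ^+ 2 = W f / M%:R.
  by rewrite sqr_sqrtr// divr_ge0 ?ler0n ?(andP (W01 f)).1.
have c0 f : 0 <= c f by exact: sqrtr_ge0.
pose v f t := (c f)%:C%C * dtft_coef J h M m f t.
have := @iid_chaos_mgf _ T R P xi K xiP _ (iota 0 M) v W (fun _ => 0) 0 (iota_uniq _ _) W01.
rewrite add0r.
have bigE (V : nmodType) (F : nat -> V) : \sum_(f <- iota 0 M) F f = \sum_(f < M) F f.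
  by rewrite -[RHS](big_mkord xpredT) /index_iota subn0.
rewrite bigE => H.
rewrite (_ : (\int[P]_w _)%E = (\int[P]_w (expR (complex.Re (symsum K (fun t => 0 * xi t w)) +
     \sum_(j <- iota 0 M) normc (symsum K (fun t => v j t * xi t w)) ^+ 2))%:E)%E); last first.
  apply: eq_integral => w _; congr (expR _)%:E.
  rewrite [complex.Re _](_ : _ = 0) ?add0r; last first.
    by rewrite /symsum big1// => i _; rewrite mul0r.
  rewrite bigE; apply: eq_bigr => f _; rewrite -/(shifted J h w) dtft_shifted//.
  rewrite (_ : symsum K (fun t => v f t * xi t w) = (c f)%:C%C * symsum K (fun t => dtft_coef J h M m f t * xi t w)).
    by rewrite Normc.normcM exprMn normc_real ger0_norm// c2; ring.
  by rewrite /symsum mulr_sumr; apply: eq_bigr => i _; rewrite /v mulrA.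
apply: H => G; rewrite add0r bigE.
pose E (t : int) := normc (\sum_(f < M) (G f * (c f)%:C%C) * ew M (- (f%:Z * t))) ^+ 2.
apply: (@le_trans _ _ (symsum m E)).
  rewrite -(@eq_symsum _ m (fun s => (fun t => E (t - h)) (s + h))); last by move=> t _ /=; rewrite addrK.
  rewrite (symsum_shift (fun t => E (t - h)) hK) /symsum mulr_suml; apply: ler_sum => i _.
  set t := i%:Z - _; rewrite bigE add0r Normc.normcM exprMn.
  rewrite (_ : normc 2 = 2); last by rewrite -(rmorph_nat (real_complex R)) normc_real ger0_norm.
  rewrite [2 ^+ 2 * _]mulrC -mulrA (_ : 2 ^+ 2 / 4 = 1) ?mulr1; last by field.
  rewrite /v /dtft_coef; case: (`|t - h| <= m%:Z)%R; last first.
    rewrite big1 ?Normc.normc0 ?expr0n ?mulr0n// => f _; by rewrite mulr0n !mulr0.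
  rewrite mulr1n; case: (J _); last first.
    rewrite big1 ?Normc.normc0 ?expr0n//; last by move=> f _; rewrite mulr0n mul0rn !mulr0.
    exact: sqr_ge0.
  by rewrite /E; under eq_bigr do rewrite !mulr1n mulrA.
apply: le_trans (bessel_opp (fun f => G f * (c f)%:C%C) mM) _.
rewrite mulr_sumr; apply: ler_sum => f _.
rewrite Normc.normcM exprMn normc_real ger0_norm// c2.
rewrite le_eqVlt; apply/orP; left; apply/eqP; field.
by rewrite gt_eqF.
Qed.

Lemma measurable_sum_normc (s : seq int) : (forall t, t \in s -> (`|t| <= K%:Z)%R) ->
  measurable_fun setT (fun w => \sum_(t <- s) normc (xi t w) ^+ 2).
Proof.
move=> sK; under eq_fun do rewrite big_seq.
under eq_fun do rewrite -big_filter.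
have mt t : t \in [seq i <- s | i \in s] -> measurable_fun setT (fun w => normc (xi t w) ^+ 2).
  rewrite mem_filter => /andP[/sK tK _]; have [m1 m2] := xiP.1 _ tK.
  under eq_fun do rewrite normc_sqrE.
  by apply: measurable_funD; apply: measurable_funX.
elim: [seq i <- s | i \in s] mt => [|t l IH] mt.
  by under eq_fun do rewrite big_nil; exact: measurable_cst.
under eq_fun do rewrite big_cons; apply: measurable_funD.
  by apply: mt; rewrite inE eqxx.
by apply: IH => u ul; apply: mt; rewrite inE ul orbT.
Qed.

(** 1/2 is the largest weight that [iid_chaos_mgf] admits, and scaled coordinate vectors meet its
    condition; each coordinate then costs 2 times 1/2. *)
Lemma sum_normc_mgf (s : seq int) : uniq s -> (forall t, t \in s -> (`|t| <= K%:Z)%R) ->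
  (\int[P]_w (expR (2^-1 * \sum_(t <- s) normc (xi t w) ^+ 2))%:E <=
   (expR (size s)%:R)%:E)%E.
Proof.
move=> us sK; pose c : R := Num.sqrt 2^-1.
have c2 : c ^+ 2 = 2^-1 by rewrite sqr_sqrtr.
have c0 : 0 <= c by exact: sqrtr_ge0.
pose v (j t : int) : R[i] := c%:C%C *+ (t == j).
have := @iid_chaos_mgf _ T R P xi K xiP _ s v (fun _ => 2^-1) (fun _ => 0) 0 us.
have sE : \sum_(j <- s) (2^-1 : R) = 2^-1 * (size s)%:R.
  by rewrite big_const_seq count_predT iter_addr_0 mulr_natr.
rewrite sE [0 + 2 * (2^-1 * _)]add0r mulrA divff// mul1r => H.
rewrite (_ : (\int[P]_w _)%E = (\int[P]_w (expR (complex.Re (symsum K (fun t => 0 * xi t w)) +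
     \sum_(j <- s) normc (symsum K (fun t => v j t * xi t w)) ^+ 2))%:E)%E); last first.
  apply: eq_integral => w _; congr (expR _)%:E.
  rewrite [complex.Re _](_ : _ = 0) ?add0r; last first.
    by rewrite /symsum big1// => i _; rewrite mul0r.
  rewrite mulr_sumr; apply: eq_big_seq => t /sK tK.
  rewrite -(@eq_symsum _ K (fun r => (c%:C%C * xi r w) *+ (r == t))); last first.
    by move=> r _; rewrite /v; case: eqP; rewrite ?mulr1n ?mulr0n ?mul0r.
  by rewrite (symsum_delta (fun r => c%:C%C * xi r w) tK) Normc.normcM exprMn normc_real ger0_norm// c2.
apply: H => [_|G]; first by rewrite invr_ge0 ler0n lexx.
rewrite add0r.
apply: (@le_trans _ _ (symsum K (fun t => \sum_(j <- s) (2^-1 * normc (G t) ^+ 2) *+ (t == j)))); last first.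
  rewrite /symsum exchange_big/= le_eqVlt; apply/orP; left; apply/eqP.
  by apply: eq_big_seq => j /sK jK; exact: (symsum_delta (fun t => 2^-1 * normc (G t) ^+ 2) jK).
rewrite /symsum mulr_suml; apply: ler_sum => i _; set t := i%:Z - _.
rewrite add0r Normc.normcM exprMn.
rewrite (_ : normc 2 = 2); last by rewrite -(rmorph_nat (real_complex R)) normc_real ger0_norm.
rewrite [2 ^+ 2 * _]mulrC -mulrA (_ : 2 ^+ 2 / 4 = 1) ?mulr1; last by field.
have E (V : nmodType) (F : int -> V) : \sum_(j <- s) F j *+ (t == j) = F t *+ (t \in s).
  elim: s us {sK sE} => [|j l IH] /=; first by rewrite big_nil.
  move=> /andP[jl ul]; rewrite big_cons IH// inE.
  by case: eqP => [->|_] /=; rewrite ?(negbTE jl) ?mulr1n ?mulr0n ?addr0 ?add0r.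
have -> : \sum_(j <- s) G j * v j t = (G t * c%:C%C) *+ (t \in s).
  by rewrite -(E _ (fun j => G j * c%:C%C)); apply: eq_bigr => j _; rewrite /v mulrnAr.
rewrite (E _ (fun _ => 2^-1 * normc (G t) ^+ 2)).
case: (t \in s); last by rewrite !mulr0n Normc.normc0 expr0n.
by rewrite !mulr1n Normc.normcM exprMn normc_real ger0_norm// c2 mulrC.
Qed.

Lemma bin_le_exp n k : ('C(n, k) <= n ^ k)%N.
Proof.
elim: n k => [|n IH] [|k]; rewrite ?bin0 ?bin0n ?expn0//.
rewrite binS; apply: leq_trans (leq_add (IH _) (IH _)) _.
rewrite [(n ^ k.+1)%N]expnS -mulSnr expnS leq_mul2l/=.
by case: k => [|k]; [rewrite !expn0|rewrite leq_exp2r].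
Qed.

Definition log9e3 (s : nat) : R := ln (9%:R * expR 3%:R * s%:R).

Lemma log9e3E s : (0 < s)%N -> log9e3 s = ln 9 + 3 + ln s%:R.
Proof.
move=> s0; rewrite /log9e3 !lnM ?posrE ?mulr_gt0 ?expR_gt0 ?ltr0n//.
by rewrite expRK.
Qed.

Lemma ln9_ge1 : 1 <= ln 9 :> R.
Proof.
have h3 : ln 3^-1 <= - 2 / 3 :> R.
  have h : ln (1 + (- 2 / 3)) <= - 2 / 3 :> R by apply: le_ln1Dx; lra.
  have e : 3^-1 = 1 + (- 2 / 3) :> R by field.
  by rewrite {1}e.
have -> : ln 9 = ln 3 + ln 3 :> R by rewrite -lnM ?posrE//; congr ln; rewrite -natrM.
by move: h3; rewrite lnV ?posrE//; lra.
Qed.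

(** Since 18 = 2 times 9 and ln 2 <= 1, 1 + ln (18 s) is below ln 9 + 3 + ln s. *)
Lemma wt_le_log s m (S : {set 'I_(2 * m).+1}) f : (0 < s)%N -> #|S| = (18 * s)%N ->
  wt S f <= 2 * log9e3 s.
Proof.
move=> s0 cS; apply: le_trans (wt_le _ _) _; first by rewrite cS; lia.
have sR : (0 : R) < s%:R by rewrite ltr0n.
rewrite ler_pM2l// cS log9e3E// natrM lnM ?posrE//.
have -> : ln 18%:R = ln 9 + ln 2 :> R.
  by rewrite -lnM ?posrE//; congr ln; rewrite -natrM.
have : ln 2 <= 1 :> R.
  by have := @le_ln1Dx R 1; apply.
lra.
Qed.

(* Chernoff's bound at exponent 1 / (4 log9e3 s), with a union over the at most
   (2m+1)^(18s) sets S and the two forms. *)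
Definition block_bound (s m : nat) (L : R) : R :=
  2 * (18 * s)%:R * (3 + 2 * ln (2 * m).+1%:R) +
  4 * log9e3 s * (L + (18 * s)%:R * ln (2 * m).+1%:R + ln 2).

Lemma block_event (s m : nat) (h : int) (J : int -> bool) (L : R) :
  (0 < s)%N -> (`|h| + (2 * m)%N%:Z <= K%:Z)%R ->
  exists A : set T, [/\ measurable A, (P A <= (expR (- L))%:E)%E &
    forall w, ~ A w -> forall S : {set 'I_(2 * m).+1}, #|S| = (18 * s)%N ->
      let M := (2 * (2 * m).+1)%N in
      let u := fun t => xi (t + h) w in
      \sum_(f < M) wt S f * (normc (dtft M m (window J u) f) ^+ 2 / M%:R) <= block_bound s m L /\
      \sum_(f < M) wt S f * (normc (dtft M (2 * m) u f) ^+ 2 / M%:R) <= block_bound s m L].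
Proof.
move=> s0 hK; set M := (2 * (2 * m).+1)%N; set r := (18 * s)%N.
pose l := log9e3 s; have l4 : 4 <= l.
  have : 0 <= ln s%:R :> R by rewrite ln_ge0// ler1n.
  by rewrite /l log9e3E//; have := ln9_ge1; lra.
(* The boolean selects one of the two transforms separated by [block_cross]: windowed noise of
   radius m, or full noise of radius 2m. *)
pose I := ({S : {set 'I_(2 * m).+1} | #|S| == r} * bool)%type.
pose mm (b : bool) := if b then m else (2 * m)%N.
pose JJ (b : bool) := if b then J else (fun _ => true).
(* Weights are at most 2l, so this scaling brings them under the limit 1/2 of the exponential
   moment. *)
pose W (i : I) f := (4 * l)^-1 * wt (val i.1) f.
pose X (i : I) w := \sum_(f < M) W i f *
   (normc (dtft M (mm i.2) (window (JJ i.2) (fun t => xi (t + h) w)) f) ^+ 2 / M%:R).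
have hm b : (`|h| + (mm b)%:Z <= K%:Z)%R by rewrite /mm; case: b; lia.
have mX i : measurable_fun setT (X i).
  have := @measurable_dtft_form (JJ i.2) h M (mm i.2) (fun f => W i f / M%:R) (hm i.2).
  congr (measurable_fun _ _); apply/funext => w; apply: eq_bigr => f _.
  by rewrite -mulrA; congr (_ * _); rewrite mulrC.
pose a : R := r%:R * (3 + 2 * ln (2 * m).+1%:R) / (2 * l).
have EX i : (\int[P]_w (expR (X i w))%:E <= (expR a)%:E)%E.
  have cS : #|val i.1| = r by apply/eqP; exact: (valP i.1).
  apply: (le_trans (dtft_form_mgf _ (hm i.2) _ _)).
  - by rewrite /mm /M; case: (i.2); lia.
  - move=> f; rewrite /W mulr_ge0 ?wt_ge0 ?invr_ge0 ?mulr_ge0//=; last by lra.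
    rewrite mulrC ler_pdivrMr; last by lra.
    by have := @wt_le_log s m (val i.1) f s0 cS; rewrite -/l; lra.
  rewrite lee_fin ler_expR /W -mulr_sumr.
  have := @sum_wt_le R m (val i.1); rewrite cS => h2.
  rewrite /a mulrA ler_pdivlMr; last by lra.
  rewrite mulrAC (_ : 2 * (4 * l)^-1 * (2 * l) = 1) ?mul1r//.
  by field; rewrite gt_eqF//; lra.
have [A [mA PA HA]] := @chernoff_family _ T R P I X (fun _ => a)
  (fun _ => L + r%:R * ln (2 * m).+1%:R + ln 2) mX EX.
exists A; split => //.
  apply: le_trans PA _; rewrite lee_fin sumr_const.
  have -> : #|{: I}| = ('C((2 * m).+1, r) * 2)%N.
    rewrite card_prod card_bool card_sig; congr (_ * _)%N.
    by rewrite -[in RHS](card_ord (2 * m).+1) -card_draws cardsE; apply: eq_card => S.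
  have N0 : (0 : R) < (2 * m).+1%:R by rewrite ltr0n.
  have e2 : expR (- (L + r%:R * ln (2 * m).+1%:R + ln 2)) =
      expR (- L) / ((2 * m).+1%:R ^+ r * 2) :> R.
    rewrite !opprD !expRD !expRN expRM_natl lnK ?posrE// lnK ?posrE//.
    by rewrite invfM mulrA.
  rewrite e2 -[_ *+ _]mulr_natr mulrAC -mulrA ler_piMr ?expR_ge0//.
  rewrite ler_pdivrMr ?mulr_gt0 ?exprn_gt0// mul1r natrM ler_pM2r//.
  by rewrite -natrX ler_nat bin_le_exp.
move=> w nA S /eqP cS /=.
have key b : \sum_(f < M) wt S f * (normc (dtft M (mm b) (window (JJ b) (fun t => xi (t + h) w)) f) ^+ 2 / M%:R) <= block_bound s m L.
  have := HA w nA (exist _ S cS, b); rewrite /X /W /=.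
  under eq_bigr do rewrite -mulrA.
  rewrite -mulr_sumr mulrC ltr_pdivrMr; last by lra.
  move=> /ltW h1; apply: le_trans h1 _.
  rewrite /block_bound -/l -/r /a le_eqVlt; apply/orP; left; apply/eqP; field.
  by rewrite gt_eqF//; lra.
split; first exact: (key true).
exact: (key false).
Qed.

End gauss_events.

(** * Cutting the observation window into blocks and edges *)

Section window_decomposition.

Lemma symsumE (V : nmodType) (p : nat) (F : int -> V) :
  symsum p F = F 0 + \sum_(0 <= j < p) (F j.+1%:Z + F (- j.+1%:Z)).
Proof.
elim: p => [|p IH]; first by rewrite big_geq// addr0 /symsum big_ord1 subrr.
rewrite big_nat_recr//= addrA -IH /symsum (_ : (2 * p.+1).+1 = (2 * p).+3)%N; last by lia.
rewrite big_ord_recr big_ord_recl /=.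
rewrite [X in X + _ + _](_ : _ = F (- p.+1%:Z)); last by congr F; lia.
rewrite [X in _ + X](_ : _ = F p.+1%:Z); last by congr F; lia.
rewrite -addrA addrC -addrA; congr (_ + _).
by apply: eq_bigr => i _; congr F; rewrite /bump/=; lia.
Qed.

Lemma symsum_opp (V : nmodType) (p : nat) (F : int -> V) :
  symsum p (fun t => F (- t)) = symsum p F.
Proof.
rewrite !symsumE oppr0; congr (_ + _); apply: eq_bigr => j _.
by rewrite opprK addrC.
Qed.

Lemma symsum_drop_left (V : nmodType) (m : nat) (h : int) (F : int -> V) :
  symsum m (fun s => F (s + h) *+ (- m%:Z < s)%R) =
  \sum_(0 <= i < 2 * m) F (h - m%:Z + i.+1%:Z).
Proof.
rewrite /symsum big_ord_recl /= sub0r ltxx mulr0n add0r big_mkord.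
apply: eq_bigr => i _; rewrite (_ : (_ < _) = true) ?mulr1n; last by rewrite /bump/=; lia.
by congr F; rewrite /bump/=; lia.
Qed.

Lemma symsum_split_left (V : nmodType) (m : nat) (F : int -> V) :
  symsum m F = F (- m%:Z) + symsum m (fun s => F s *+ (- m%:Z < s)%R).
Proof.
rewrite /symsum !big_ord_recl /= !sub0r ltxx mulr0n add0r; congr (_ + _).
apply: eq_bigr => i _; rewrite (_ : (_ < _) = true) ?mulr1n//.
by rewrite /bump/=; lia.
Qed.

(* The interval I^(k,+) (e = true) or I^(k,-) (e = false), recentered at 0, is the
   full window of radius m minus one endpoint. *)
Definition inner (e : bool) (m : nat) (s : int) : bool :=
  if e then (- m%:Z < s) else (s < m%:Z).

Definition edge_point (e : bool) (m : nat) : int := if e then - m%:Z else m%:Z.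

Lemma symsum_split (V : nmodType) e (m : nat) (F : int -> V) :
  symsum m F = F (edge_point e m) + symsum m (fun s => F s *+ inner e m s).
Proof.
case: e; first exact: symsum_split_left.
rewrite -symsum_opp symsum_split_left opprK; congr (_ + _).
rewrite -symsum_opp; apply: eq_symsum => t _ /=; rewrite opprK.
by congr (_ *+ _); congr nat_of_bool; lia.
Qed.

Definition block_center (n : nat) (k : nat) (e : bool) : int :=
  let h := (2 * n)%N%:Z - (2 * (n %/ 3 ^ k))%N%:Z in if e then h else - h.

(** Divisibility makes each radius exactly three times the next, m. The next pair of blocks then
    occupies 2n - 3m < |t| <= 2n - m, starting where the previous pair ended, and the cover
    telescopes up to the edges. *)
Lemma symsum_blocks (V : nmodType) (n K : nat) (F : int -> V) : (3 ^ K %| n)%N ->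
  symsum (2 * n) F = symsum n F +
  \sum_(k < K) \sum_(e : bool)
     symsum (n %/ 3 ^ k.+1) (fun s => F (s + block_center n k.+1 e) *+ inner e (n %/ 3 ^ k.+1) s) +
  \sum_(2 * n - n %/ 3 ^ K <= j < 2 * n) (F j.+1%:Z + F (- j.+1%:Z)).
Proof.
move=> /dvdnP[q nq].
have nk k : (k <= K)%N -> (n %/ 3 ^ k = q * 3 ^ (K - k))%N.
  by move=> kK; rewrite nq -{1}(subnK kK) expnD mulnA mulnK// expn_gt0.
pose G j := F j.+1%:Z + F (- j.+1%:Z).
have n0 : (n %/ 3 ^ 0 = n)%N by rewrite expn0 divn1.
have nle k : (n %/ 3 ^ k <= n)%N by exact: leq_div.
rewrite [LHS]symsumE -/G [symsum n F]symsumE -/G -!addrA; congr (_ + _).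
rewrite (@big_cat_nat _ _ _ n) /=; [|by []|by lia].
congr (_ + _); rewrite (@big_cat_nat _ _ _ (2 * n - n %/ 3 ^ K)) /=; last 2 first.
- by have := nle K; set a := (n %/ 3 ^ K)%N; lia.
- exact: leq_subr.

congr (_ + _).
have main K' : (K' <= K)%N -> \sum_(n <= j < 2 * n - n %/ 3 ^ K') G j =
    \sum_(k < K') \sum_(e : bool)
     symsum (n %/ 3 ^ k.+1) (fun s => F (s + block_center n k.+1 e) *+ inner e (n %/ 3 ^ k.+1) s).
  elim: K' => [|K' IH] KK; first by rewrite big_ord0 big_geq// n0 mul2n -addnn addnK.
  rewrite big_ord_recr/= -IH ?(ltnW KK)//.
  set m := (n %/ 3 ^ K'.+1)%N.
  have m3 : (n %/ 3 ^ K' = 3 * m)%N.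
    rewrite /m !nk ?(ltnW KK)// mulnCA -expnS; congr (_ * 3 ^ _)%N; lia.
  have mn := nle K'; rewrite m3 in mn *.
  rewrite (@big_cat_nat _ _ _ (2 * n - 3 * m)) /=; [|by lia|by lia].
  congr (_ + _); rewrite big_bool /=.
  have half (H : int -> V) : \sum_(2 * n - 3 * m <= j < 2 * n - m) H j.+1%:Z =
      symsum m (fun s => H (s + block_center n K'.+1 true) *+ inner true m s).
    rewrite /inner symsum_drop_left -{1}[(2 * n - 3 * m)%N]add0n big_addn.
    rewrite (_ : (2 * n - m - (2 * n - 3 * m) = 2 * m)%N); last by lia.
    by apply: eq_bigr => i _; congr H; rewrite /block_center -/m; lia.
  rewrite /G big_split/= half (half (fun t => F (- t))); congr (_ + _).
  rewrite -symsum_opp; apply: eq_symsum => s sm; rewrite /inner /block_center -/m.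
  by congr (F _ *+ _); [lia|congr nat_of_bool; lia].
exact: main.
Qed.

End window_decomposition.

(** * Deterministic bounds on one block *)

Section block_consequences.
Context {R : realType}.
Local Notation C := R[i].
Local Notation normc := Normc.normc.

(** The conclusion of [block_event] for one fixed realization; from here on the block estimates are
    deterministic. *)
Definition block_good (s m : nat) (J : int -> bool) (u : cseq R) (b : R) : Prop :=
  forall S : {set 'I_(2 * m).+1}, #|S| = (18 * s)%N ->
    let M := (2 * (2 * m).+1)%N in
    \sum_(f < M) wt S f * (normc (dtft M m (window J u) f) ^+ 2 / M%:R) <= b /\
    \sum_(f < M) wt S f * (normc (dtft M (2 * m) u f) ^+ 2 / M%:R) <= b.

Section consequences.
Variables (s m : nat) (J : int -> bool) (u : cseq R) (b : R).
Hypotheses (s0 : (0 < s)%N) (sm : (18 * s <= (2 * m).+1)%N) (good : block_good s m J u b).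
Let M := (2 * (2 * m).+1)%N.
Let M0 : (0 : R) < M%:R. Proof. by rewrite ltr0n /M; lia. Qed.

Lemma good_cross (phi : cseq R) : feasible s m phi ->
  normc (symsum m (fun t => window J (fun t => conjc (u t)) t * Defs.conv m phi u t)) <=
  c_star R * b.
Proof.
move=> feas; rewrite -(ler_pM2l M0); apply: le_trans (block_cross _ _ _ _) _.
have hA := feasible_dominated (q := fun f => normc (dtft M m (window J u) f) ^+ 2 / M%:R)
  s0 sm feas (fun f => divr_ge0 (sqr_ge0 _) (ler0n _ _)) (fun S cS => (good cS).1).
have hB := feasible_dominated (q := fun f => normc (dtft M (2 * m) u f) ^+ 2 / M%:R)
  s0 sm feas (fun f => divr_ge0 (sqr_ge0 _) (ler0n _ _)) (fun S cS => (good cS).2).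
have -> : M%:R * (c_star R * b) = M%:R / 2 * (c_star R * b + c_star R * b) by field.
apply: (@le_trans _ _ (M%:R / 2 * (\sum_(f < M) normc (dtft M m phi f) *
    (normc (dtft M m (window J u) f) ^+ 2 / M%:R) +
   \sum_(f < M) normc (dtft M m phi f) * (normc (dtft M (2 * m) u f) ^+ 2 / M%:R)))); last first.
  by rewrite ler_pM2l ?divr_gt0//; exact: lerD.
rewrite -big_split/= mulr_sumr le_eqVlt; apply/orP; left; apply/eqP.
by apply: eq_bigr => f _; field; rewrite gt_eqF.
Qed.

(** The energy is quadratic in the response; as the response is at most 1, its square is below
    itself and the linear domination applies. *)
Lemma good_energy (phi : cseq R) : feasible s m phi ->
  (forall f, normc (dtft M m phi f) <= 1) ->
  symsum m (fun t => normc (Defs.conv m phi u t) ^+ 2) <= c_star R * b.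
Proof.
move=> feas phi1; rewrite -(ler_pM2l M0); apply: le_trans (block_energy _ _ _) _.
have hB := feasible_dominated (q := fun f => normc (dtft M (2 * m) u f) ^+ 2 / M%:R)
  s0 sm feas (fun f => divr_ge0 (sqr_ge0 _) (ler0n _ _)) (fun S cS => (good cS).2).
apply: (@le_trans _ _ (M%:R * \sum_(f < M) normc (dtft M m phi f) * (normc (dtft M (2 * m) u f) ^+ 2 / M%:R))).
  rewrite mulr_sumr; apply: ler_sum => f _.
  rewrite [leRHS](_ : _ = normc (dtft M m phi f) * normc (dtft M (2 * m) u f) ^+ 2); last first.
    by field; rewrite gt_eqF.
  apply: ler_wpM2r; first exact: sqr_ge0.
  by rewrite expr2 ler_piMl ?normc_ge0.
by rewrite ler_pM2l.
Qed.

End consequences.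

Lemma convZ_shift (m : nat) (phi y u : cseq R) (c : C) (h t : int) (K : nat) :
  (`|h| + (2 * m)%N%:Z <= K%:Z)%R -> (`|t| <= m%:Z)%R ->
  (forall r : int, (`|r| <= K%:Z)%R -> y r = c * u (r - h)) ->
  Defs.conv m phi y (t + h) = c * Defs.conv m phi u t.
Proof.
move=> hK tm yu; rewrite /Defs.conv /symsum mulr_sumr; apply: eq_bigr => i _.
set r := i%:Z - _; have rm : (`|r| <= m%:Z)%R by rewrite /r; have := ltn_ord i; lia.
rewrite yu; last by lia.
have -> : t + h - r - h = t - r by lia.
by rewrite mulrCA.
Qed.

Lemma normc_sqrB (a b : C) :
  normc (a - b) ^+ 2 = normc a ^+ 2 + normc b ^+ 2 - 2 * complex.Re (conjc a * b).
Proof. by rewrite !normc_sqrE; case: a => ? ?; case: b => ? ? /=; ring. Qed.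

(** Expanding the difference of squares leaves twice a cross term minus |xh|^2, and the latter is
    dropped. [good_cross] covers all feasible filters at once, so [phi] may depend on the noise. *)
Lemma null_block (s m K : nat) (J : int -> bool) (h : int) (y xh xi phi : cseq R) (sigma b : R) :
  (0 < s)%N -> (18 * s <= (2 * m).+1)%N -> (`|h| + (2 * m)%N%:Z <= K%:Z)%R ->
  (forall t : int, (`|t| <= K%:Z)%R -> y t = sigma%:C%C * xi t) ->
  block_good s m J (fun t => xi (t + h)) b ->
  feasible s m phi ->
  (forall t : int, (`|t| <= m%:Z)%R -> J t -> xh (t + h) = Defs.conv m phi y (t + h)) ->
  symsum m (fun t => (normc (y (t + h)) ^+ 2 - normc (y (t + h) - xh (t + h)) ^+ 2) *+ J t)
    <= 2 * sigma ^+ 2 * (c_star R * b).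
Proof.
move=> s0 sm hK yE good feas xhE; pose u t := xi (t + h).
have cE t : (`|t| <= m%:Z)%R -> Defs.conv m phi y (t + h) = sigma%:C%C * Defs.conv m phi u t.
  move=> tm; rewrite (@convZ_shift m phi y u sigma%:C%C h t K)// => r rK.
  by rewrite yE// /u; congr (_ * xi _); lia.
apply: (@le_trans _ _ (symsum m (fun t => 2 * sigma ^+ 2 *
    complex.Re (window J (fun t => conjc (u t)) t * Defs.conv m phi u t)))).
  apply: ler_symsum => t tm; rewrite /window; case Jt : (J t); last first.
    by rewrite !mulr0n mul0r mulr0.
  rewrite !mulr1n normc_sqrB xhE// cE// yE; last by lia.
  rewrite -/(u t); set z := Defs.conv _ _ _ _.
  have -> : complex.Re (conjc (sigma%:C%C * u t) * (sigma%:C%C * z)) =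
            sigma ^+ 2 * complex.Re (conjc (u t) * z).
    by case: (u t) => ? ?; case: z => ? ? /=; ring.
  by have := sqr_ge0 (normc (sigma%:C%C * z)); lra.
rewrite /symsum -mulr_sumr -complex_Re_sum; apply: ler_wpM2l.
  by rewrite mulr_ge0 ?sqr_ge0.
apply: le_trans (good_cross s0 sm good feas).
by apply: le_trans (ler_norm _) (Re_le_normc _).
Qed.

(** The loss runs over the full window, so restriction to [J] only lowers the left side. Against
    [psi] the residual is sigma times u minus its convolution with psi; squaring gives the energy of
    u, a filtered energy and twice a cross term, hence the 3. *)
Lemma signal_block (s m K : nat) (J : int -> bool) (h : int) (x y xh xi phi : cseq R) (sigma b : R) :
  (0 < s)%N -> (9 * s <= m)%N -> (`|h| + (2 * m)%N%:Z <= K%:Z)%R -> 0 <= sigma -> Xs s x ->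
  (forall t : int, y t = x t + sigma%:C%C * xi t) ->
  block_good s m (fun _ => true) (fun t => xi (t + h)) b ->
  is_minimizer s m h y phi ->
  (forall t : int, (`|t| <= m%:Z)%R -> J t -> xh (t + h) = Defs.conv m phi y (t + h)) ->
  symsum m (fun t => normc (y (t + h) - xh (t + h)) ^+ 2 *+ J t)
    <= sigma ^+ 2 * (symsum m (fun t => normc (xi (t + h)) ^+ 2) + 3 * (c_star R * b)).
Proof.
move=> s0 sm hK sig0 xX yE good [feas minphi] xhE; pose u t := xi (t + h).
have sm' : (18 * s <= (2 * m).+1)%N by lia.
have [psi [fpsi rpsi psi1]] := oracle_filter xX s0 (leq_trans (leq_trans (leq_pmull s (isT : 0 < 9)%N) sm) (leqnSn m)).
apply: (@le_trans _ _ (symsum m (fun t => normc (Defs.conv m phi y (t + h) - y (t + h)) ^+ 2))).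
  apply: ler_symsum => t tm; case Jt : (J t); last by rewrite mulr0n sqr_ge0.
  by rewrite mulr1n xhE// -normcN opprB.
apply: (@le_trans _ _ (symsum m (fun t => normc (Defs.conv m psi y (t + h) - y (t + h)) ^+ 2))).
  have := minphi psi fpsi; rewrite /fit_loss /norm2 ler_sqrt//.
  by apply: sumr_ge0 => i _; exact: sqr_ge0.
have dE t : normc (Defs.conv m psi y (t + h) - y (t + h)) ^+ 2 =
    sigma ^+ 2 * normc (u t - Defs.conv m psi u t) ^+ 2.
  have -> : Defs.conv m psi y (t + h) - y (t + h) = sigma%:C%C * (Defs.conv m psi u t - u t).
    have -> : Defs.conv m psi y (t + h) = Defs.conv m psi x (t + h) + sigma%:C%C * Defs.conv m psi u t.
      rewrite /Defs.conv /symsum mulr_sumr -big_split/=; apply: eq_bigr => i _.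
      rewrite yE mulrDr /u; congr (_ + _); rewrite mulrCA; congr (_ * (_ * xi _)); lia.
    by rewrite rpsi yE /u; ring.
  by rewrite Normc.normcM exprMn normc_real ger0_norm// -normcN opprB.
rewrite (@eq_symsum _ _ _ _ (fun t _ => dE t)) /symsum -mulr_sumr.
apply: ler_wpM2l; first exact: sqr_ge0.
rewrite -/(symsum m (fun t => normc (u t - Defs.conv m psi u t) ^+ 2)).
apply: (@le_trans _ _ (symsum m (fun t => normc (u t) ^+ 2) +
   symsum m (fun t => normc (Defs.conv m psi u t) ^+ 2) -
   2 * complex.Re (symsum m (fun t => window (fun _ => true) (fun t => conjc (u t)) t * Defs.conv m psi u t)))).
  rewrite /symsum complex_Re_sum mulr_sumr -big_split/= -sumrB; apply: ler_sum => i _.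
  by rewrite normc_sqrB /window mulr1n.
rewrite -addrA lerD2l.
have h1 := good_energy s0 sm' good fpsi (psi1 _).
have h2 := good_cross s0 sm' good fpsi.
have := Re_le_normc (symsum m (fun t => window (fun _ => true) (fun t => conjc (u t)) t * Defs.conv m psi u t)).
rewrite ler_norml => /andP[h3 _].
by move: h1 h2 h3; rewrite -/u; lra.
Qed.

End block_consequences.

(** * Unions of exceptional sets *)

Section union_of_events.
Context d (T : measurableType d) (R : realType) (P : probability T R).

Lemma union_events (I : finType) (Q : I -> T -> Prop) (p : R) :
  (forall i, exists A : set T, [/\ measurable A, (P A <= p%:E)%E & forall w, ~ A w -> Q i w]) ->
  exists A : set T, [/\ measurable A, (P A <= (#|I|%:R * p)%:E)%E &
    forall w, ~ A w -> forall i, Q i w].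
Proof.
move=> /choice[A HA].
have mA i : measurable (A i) by have [] := HA i.
have mU : measurable (\bigcup_(i in [set: I]) A i).
  by apply: fin_bigcup_measurable => [|i _]; [exact: finite_finset|exact: mA].
exists (\bigcup_(i in [set: I]) A i); split => //; last first.
  by move=> w nA i; have [_ _] := HA i; apply => Aiw; apply: nA; exists i.
rewrite -(setIT (\bigcup_(i in _) _)) -integral_indic//.
apply: (@le_trans _ _ (\int[P]_w (\sum_i (\1_(A i) w)%:E))%E).
  apply: ge0_le_integral => //.
  - by apply/measurable_EFinP; exact: measurable_indic.
  - under eq_fun do rewrite sumEFin.
    apply/measurable_EFinP.
    by apply: measurable_sum => i; exact: measurable_indic.
  - move=> w _; rewrite sumEFin lee_fin [leLHS]indicE.
    have [/set_mem[i _ Aiw]|_] := boolP (w \in _); last by apply: sumr_ge0.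
    rewrite (bigD1 i)//= indicE mem_set//= lerDl.
    by apply: sumr_ge0.
rewrite ge0_integral_sum//; last first.
  by move=> i; apply/measurable_EFinP; exact: measurable_indic.
apply: (@le_trans _ _ (\sum_(i : I) p%:E)%E).
  apply: lee_sum => i _; rewrite integral_indic// setIT.
  by have [] := HA i.
by rewrite sumEFin lee_fin sumr_const mulr_natl.
Qed.

Lemma union2_events (Q1 Q2 : T -> Prop) (p1 p2 : R) :
  (exists A : set T, [/\ measurable A, (P A <= p1%:E)%E & forall w, ~ A w -> Q1 w]) ->
  (exists A : set T, [/\ measurable A, (P A <= p2%:E)%E & forall w, ~ A w -> Q2 w]) ->
  exists A : set T, [/\ measurable A, (P A <= (p1 + p2)%:E)%E &
    forall w, ~ A w -> Q1 w /\ Q2 w].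
Proof.
move=> [A1 [mA1 P1 H1]] [A2 [mA2 P2 H2]]; exists (A1 `|` A2); split.
- exact: measurableU.
- apply: le_trans (measureU2 _ mA1 mA2) _.
  by rewrite EFinD; exact: leeD.
- by move=> w nA; split; [apply: H1|apply: H2] => h; apply: nA; [left|right].
Qed.

Lemma chernoff1 (X : T -> R) (a L : R) : measurable_fun setT X ->
  (\int[P]_w (expR (X w))%:E <= (expR a)%:E)%E ->
  exists A : set T, [/\ measurable A, (P A <= (expR (- L))%:E)%E &
    forall w, ~ A w -> X w < a + L].
Proof.
move=> mX EX.
have [A [mA PA HA]] := @chernoff_family _ T R P unit (fun _ => X) (fun _ => a) (fun _ => L)
  (fun _ => mX) (fun _ => EX).
exists A; split => //; last by move=> w nA; exact: (HA w nA tt).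
by apply: le_trans PA _; rewrite lee_fin sumr_const card_unit mulr1n.
Qed.

End union_of_events.

(** * Numerical constants of the threshold *)

Section numeric.
Context {R : realType}.

(** The terms in s log (2n+1) fix the factor 30: l >= 4 gives 72 + 72 l <= 90 l. *)
Lemma block_bound_le (s m n : nat) (L : R) : (0 < s)%N -> (m <= n)%N -> 0 <= L ->
  block_bound s m L <= 30 * log9e3 R s *
    (6 * s%:R + 3 * s%:R * ln (2 * n).+1%:R + log9e3 R s * L).
Proof.
move=> s0 mn L0; rewrite /block_bound; set l := log9e3 R s.
have l4 : 4 <= l.
  have : 0 <= ln s%:R :> R by rewrite ln_ge0// ler1n.
  by rewrite /l log9e3E//; have := @ln9_ge1 R; lra.
set x : R := ln (2 * m).+1%:R; set y : R := ln (2 * n).+1%:R.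
have xy : x <= y by rewrite ler_ln ?posrE ?ltr0n// ler_nat; lia.
have x0 : 0 <= x by rewrite ln_ge0// ler1n.
have l2 : ln 2 <= 1 :> R by have := @le_ln1Dx R 1; apply.
rewrite natrM; set S : R := s%:R; have S1 : 1 <= S by rewrite ler1n.
have h1 : S * x <= S * y by rewrite ler_pM2l//; lra.
have h0 : 0 <= S * y by rewrite mulr_ge0//; lra.
have h2 : 4 * (S * y) <= l * (S * y) by rewrite ler_wpM2r.
have h3 : l * (S * x) <= l * (S * y) by rewrite ler_wpM2l//; lra.
have h4 : 4 * S <= l * S by rewrite ler_wpM2r//; lra.
have h5 : l * 1 <= l * S by rewrite ler_wpM2l//; lra.
have h6 : 0 <= l * L by rewrite mulr_ge0//; lra.
have h7 : 4 * (l * L) <= l * (l * L) by rewrite ler_wpM2r.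
have h8 : l * ln 2 <= l * 1 by rewrite ler_wpM2l//; lra.
have -> : 2 * (18 * S) * (3 + 2 * x) + 4 * l * (L + 18 * S * x + ln 2) =
  108 * S + 72 * (S * x) + 4 * (l * L) + 72 * (l * (S * x)) + 4 * (l * ln 2) by ring.
have -> : 30 * l * (6 * S + 3 * S * y + l * L) =
  180 * (l * S) + 90 * (l * (S * y)) + 30 * (l * (l * L)) by ring.
lra.
Qed.

(** With c = c_star, S = s, La = log (2n+1) and k = K, there are 1 + 2k blocks. On the null side 80
    is 5/8 of 128; on the signal side 32 is what remains of 7/8 of 128 above 80. *)
Lemma numeric_margins (c l S La L k : R) : 14 <= c -> 4 <= l -> 1 <= S -> 0 <= La ->
  0 <= L -> 0 <= k ->
  let Xi := 6 * S + 3 * S * La + l * L in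
  let B := 30 * l * Xi in
  (1 + 2 * k) * (2 * (c * B)) + 2 * (18 * S + L) <= 80 * (c ^+ 2 * (Xi * (l + 1) * (k + 2))) /\
  8 * L + 2 * k * (2 * (1 + L)) + (1 + 2 * k) * (3 * (c * B)) <
    32 * (c ^+ 2 * (Xi * (l + 1) * (k + 2))).
Proof.
move=> c14 l4 S1 La0 L0 k0 Xi B.
have SL : 0 <= S * La by rewrite mulr_ge0//; lra.
have lL : 4 * L <= l * L by rewrite ler_wpM2r.
have X6 : 6 * S + 4 * L <= Xi by rewrite /Xi; lra.
set Z := Xi * ((l + 1) * (k + 2)).
(* The factors l + 1 = log (9 e^4 s) and k + 2 = log_3 (n/s) of the threshold absorb the l in the
   block bound and the number of blocks. *)
have q1 : l * (1 + 2 * k) <= 2 * ((l + 1) * (k + 2)) by nra.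
have q2 : 5 * (k + 2) <= (l + 1) * (k + 2) by rewrite ler_wpM2r//; lra.
have z1 : Xi * (l * (1 + 2 * k)) <= Xi * (2 * ((l + 1) * (k + 2))).
  by rewrite ler_wpM2l//; lra.
have z2 : Xi * (5 * (k + 2)) <= Z by rewrite /Z ler_wpM2l//; lra.
have Xk0 : 0 <= Xi * k by rewrite mulr_ge0//; lra.
have z3 : 0 < Z by lra.
have c1 : 14 * Z <= c * Z by rewrite ler_wpM2r//; lra.
have c2 : 14 * (c * Z) <= c * (c * Z) by rewrite ler_wpM2r//; lra.
have z1' : c * (Xi * (l * (1 + 2 * k))) <= c * (Xi * (2 * ((l + 1) * (k + 2)))).
  by rewrite ler_wpM2l//; lra.
have kL : k * (1 + L) <= k * Xi by rewrite ler_wpM2l//; lra.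
have -> : (1 + 2 * k) * (2 * (c * B)) = 60 * (c * (Xi * (l * (1 + 2 * k)))).
  by rewrite /B; ring.
have -> : (1 + 2 * k) * (3 * (c * B)) = 90 * (c * (Xi * (l * (1 + 2 * k)))).
  by rewrite /B; ring.
have -> : c ^+ 2 * (Xi * (l + 1) * (k + 2)) = c * (c * Z) by rewrite /Z; ring.
have e : c * (Xi * (2 * ((l + 1) * (k + 2)))) = 2 * (c * Z) by rewrite /Z; ring.
by rewrite e in z1'; split; lra.
Qed.

End numeric.

(** * Powers of three and a uniform description of the blocks *)

Section grid.

Lemma Kof_pow a b : (9 * 3 ^ a <= 3 ^ b)%N ->
  (a + 2 <= b)%N /\ Kof (3 ^ b) (3 ^ a) = (b - (a + 2))%N.
Proof.
have e9 : (9 * 3 ^ a = 3 ^ (a + 2))%N by rewrite expnD mulnC.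
rewrite e9 leq_exp2l// => ab; split => //.
by rewrite /Kof e9 -expnB// trunc_expnK.
Qed.

Lemma pow_div b k : (k <= b)%N -> (3 ^ b %/ 3 ^ k = 3 ^ (b - k))%N.
Proof. by move=> kb; rewrite expnB. Qed.

Lemma block_center_bound n k e :
  (`|block_center n k e| + (2 * (n %/ 3 ^ k))%N%:Z <= (2 * n)%N%:Z)%R.
Proof.
have := leq_div n (3 ^ k); set m := (n %/ 3 ^ k)%N => mn.
by rewrite /block_center -/m; case: e; lia.
Qed.

Lemma block_center0 n e : block_center n 0 e = 0.
Proof. by rewrite /block_center expn0 divn1 subrr oppr0; case: e. Qed.

(** The central window is treated as block 0, centred at 0 for either sign, so that one statement
    covers all blocks. *)
Lemma xfull_block (R : realType) s n (y xh : cseq R) : is_xfull s n y xh ->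
  forall k e, (k <= Kof n s)%N -> exists phi,
    is_minimizer s (n %/ 3 ^ k) (block_center n k e) y phi /\
    forall t : int, (`|t| <= (n %/ 3 ^ k)%N%:Z)%R -> (k == 0%N) || inner e (n %/ 3 ^ k) t ->
      xh (t + block_center n k e) = Defs.conv (n %/ 3 ^ k) phi y (t + block_center n k e).
Proof.
move=> [[phi [mphi Hphi]] [Hk _]] [|k] e kK.
  exists phi; rewrite block_center0 expn0 divn1; split => // t tn _.
  by rewrite addr0; apply: Hphi.
have [[phi1 [m1 H1]] [phi2 [m2 H2]]] := Hk k.+1 kK.
move: H1 H2 m1 m2; set m := (n %/ 3 ^ k.+1)%N => H1 H2 m1 m2.
case: e; [exists phi1|exists phi2]; rewrite /block_center -/m; split => // t tm /=.
  by move=> mt; apply: H1; lia.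
by move=> mt; apply: H2; lia.
Qed.

End grid.

(** * Upper and lower bounds for the statistic *)

Section test_statistic.
Context {R : realType}.
Local Notation normc := Normc.normc.

Lemma norm2_sqr p (u : cseq R) : norm2 p u ^+ 2 = symsum p (fun t => normc (u t) ^+ 2).
Proof. by rewrite sqr_sqrtr//; apply: sumr_ge0 => i _; exact: sqr_ge0. Qed.

Lemma norm2_eq0 p (u : cseq R) : norm2 p u = 0 -> forall t : int, (`|t| <= p%:Z)%R -> u t = 0.
Proof.
move=> u0 t tp; apply: Normc.eq0_normc; apply/eqP; rewrite -sqrf_eq0.
rewrite eq_le sqr_ge0 andbT.
have <- : symsum p (fun t => normc (u t) ^+ 2) = 0 by rewrite -norm2_sqr u0 expr0n.
rewrite -(symsum_delta (fun r => normc (u r) ^+ 2) tp); apply: ler_symsum => r _.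
by case: (_ == _); rewrite ?mulr1n ?mulr0n ?sqr_ge0.
Qed.

Lemma TstatE n (y xh : cseq R) : Tstat n y xh =
  symsum (2 * n) (fun t => normc (y t) ^+ 2 - normc (y t - xh t) ^+ 2).
Proof. by rewrite /Tstat !norm2_sqr /symsum sumrB. Qed.

Definition edges (s n : nat) : seq int :=
  [seq j.+1%:Z | j <- index_iota (2 * n - 9 * s) (2 * n)] ++
  [seq - j.+1%:Z | j <- index_iota (2 * n - 9 * s) (2 * n)].

Lemma sum_edges s n (F : int -> R) : \sum_(t <- edges s n) F t =
  \sum_(2 * n - 9 * s <= j < 2 * n) (F j.+1%:Z + F (- j.+1%:Z)).
Proof. by rewrite /edges big_cat/= !big_map big_split. Qed.

Lemma size_edges s n : (9 * s <= n)%N -> size (edges s n) = (18 * s)%N.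
Proof. by move=> sn; rewrite size_cat !size_map !size_iota; lia. Qed.

Lemma uniq_edges s n : uniq (edges s n).
Proof.
rewrite cat_uniq !map_inj_uniq ?iota_uniq ?andbT//=; last 2 first.
- by move=> i j /oppr_inj [].
- by move=> i j [].
by apply/hasPn => t /mapP [j _ ->]; apply/negP => /mapP [k _]; lia.
Qed.

Lemma edges_le s n t : t \in edges s n -> (`|t| <= (2 * n)%N%:Z)%R.
Proof.
by rewrite mem_cat => /orP[] /mapP [j]; rewrite mem_index_iota => ? ->; lia.
Qed.

(** The half-open interval of a block inside its full window; the central window keeps both
    endpoints. *)
Definition jk (n k : nat) (e : bool) (t : int) : bool := (k == 0%N) || inner e (n %/ 3 ^ k) t.

Section deterministic.
Variables (s n : nat) (y xh xi : cseq R) (sigma B : R).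
Local Notation K := (Kof n s).
Hypotheses (s0 : (0 < s)%N) (dvdK : (3 ^ K %| n)%N) (nK : (n %/ 3 ^ K = 9 * s)%N).
Hypothesis ms : forall k, (k <= K)%N -> (9 * s <= n %/ 3 ^ k)%N.
Hypothesis xfull : is_xfull s n y xh.
Hypothesis sig0 : 0 <= sigma.

Let sum_const_blocks (c : R) : \sum_(k < K) \sum_(e : bool) c = 2 * K%:R * c.
Proof.
under eq_bigr do rewrite big_bool/=.
by rewrite sumr_const card_ord -[_ *+ K]mulr_natl; ring.
Qed.

Lemma Tstat_null (E : R) :
  (forall t : int, (`|t| <= (2 * n)%N%:Z)%R -> y t = sigma%:C%C * xi t) ->
  (forall k e, (k <= K)%N ->
    block_good s (n %/ 3 ^ k) (jk n k e) (fun t => xi (t + block_center n k e)) B) ->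
  \sum_(t <- edges s n) normc (xi t) ^+ 2 <= E ->
  Tstat n y xh <= sigma ^+ 2 * ((1 + 2 * K%:R) * (2 * (c_star R * B)) + E).
Proof.
move=> yE good hE.
have block k e : (k <= K)%N ->
    symsum (n %/ 3 ^ k) (fun t => (normc (y (t + block_center n k e)) ^+ 2 -
      normc (y (t + block_center n k e) - xh (t + block_center n k e)) ^+ 2) *+ jk n k e t)
    <= 2 * sigma ^+ 2 * (c_star R * B).
  move=> kK; have [phi [[feas _] xhE]] := xfull_block xfull e kK.
  apply: (null_block (K := (2 * n)%N) s0 _ _ yE (good k e kK) feas xhE).
    by have := ms kK; lia.
  by have := block_center_bound n k e.
rewrite TstatE (symsum_blocks _ dvdK).
have -> : sigma ^+ 2 * ((1 + 2 * K%:R) * (2 * (c_star R * B)) + E) =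
  2 * sigma ^+ 2 * (c_star R * B) + 2 * K%:R * (2 * sigma ^+ 2 * (c_star R * B)) + sigma ^+ 2 * E.
  by ring.
apply: lerD; first apply: lerD.
- have := block 0%N true (leq0n _); rewrite block_center0 expn0 divn1.
  by apply: le_trans; rewrite le_eqVlt; apply/orP; left; apply/eqP/eq_symsum => t _; rewrite addr0.
- rewrite -sum_const_blocks; apply: ler_sum => k _; apply: ler_sum => e _.
  exact: (block k.+1 e (ltn_ord k)).
- rewrite nK -(sum_edges s n (fun t => normc (y t) ^+ 2 - normc (y t - xh t) ^+ 2)).
  apply: (@le_trans _ _ (\sum_(t <- edges s n) sigma ^+ 2 * normc (xi t) ^+ 2)).
    rewrite big_seq [leRHS]big_seq; apply: ler_sum => t /edges_le tn.
    rewrite (yE t tn) Normc.normcM exprMn normc_real ger0_norm//.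
    by rewrite gerBl sqr_ge0.
  by rewrite -mulr_sumr ler_wpM2l ?sqr_ge0.
Qed.

(** The endpoint that the half-open interval omits. [signal_block] compares with the noise energy of
    the full window, so the noise at this point is an excess to be paid for. *)
Definition dropped_point (k : nat) (e : bool) : int :=
  edge_point e (n %/ 3 ^ k.+1) + block_center n k.+1 e.

(** The noise energy occurs both in the norm of y and in the residual bound and cancels; it never
    has to be estimated over the whole window. *)
Lemma Tstat_signal (x : cseq R) (E : R) : Xs s x ->
  (forall t : int, y t = x t + sigma%:C%C * xi t) ->
  (forall k e, (k <= K)%N ->
    block_good s (n %/ 3 ^ k) (fun _ => true) (fun t => xi (t + block_center n k e)) B) ->
  (forall k e, (k < K)%N -> normc (xi (dropped_point k e)) ^+ 2 <= E) ->
  norm2 (2 * n) x ^+ 2 + 2 * sigma * complex.Re (symsum (2 * n) (fun t => conjc (x t) * xi t)) -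
    sigma ^+ 2 * (2 * K%:R * E + (1 + 2 * K%:R) * (3 * (c_star R * B)))
  <= Tstat n y xh.
Proof.
move=> xX yE good hE.
have block k e : (k <= K)%N ->
    symsum (n %/ 3 ^ k) (fun t =>
      normc (y (t + block_center n k e) - xh (t + block_center n k e)) ^+ 2 *+ jk n k e t)
    <= sigma ^+ 2 * (symsum (n %/ 3 ^ k) (fun t => normc (xi (t + block_center n k e)) ^+ 2) +
       3 * (c_star R * B)).
  move=> kK; have [phi [minphi xhE]] := xfull_block xfull e kK.
  apply: (signal_block (K := (2 * n)%N) s0 (ms kK) _ sig0 xX yE (good k e kK) minphi xhE).
  by have := block_center_bound n k e.
have res : symsum (2 * n) (fun t => normc (y t - xh t) ^+ 2) <=
    sigma ^+ 2 * symsum (2 * n) (fun t => normc (xi t) ^+ 2) +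
    sigma ^+ 2 * (2 * K%:R * E + (1 + 2 * K%:R) * (3 * (c_star R * B))).
  rewrite (symsum_blocks (fun t => normc (y t - xh t) ^+ 2) dvdK).
  rewrite (symsum_blocks (fun t => normc (xi t) ^+ 2) dvdK).
  have -> : forall A1 A2 A3 : R, sigma ^+ 2 * (A1 + A2 + A3) +
     sigma ^+ 2 * (2 * K%:R * E + (1 + 2 * K%:R) * (3 * (c_star R * B))) =
     sigma ^+ 2 * (A1 + 3 * (c_star R * B)) +
     (sigma ^+ 2 * A2 + 2 * K%:R * (sigma ^+ 2 * (E + 3 * (c_star R * B)))) + sigma ^+ 2 * A3.
    by move=> A1 A2 A3; ring.
  apply: lerD; first apply: lerD.
  - have := block 0%N true (leq0n _); rewrite block_center0 expn0 divn1 => h.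
    rewrite (@eq_symsum _ _ _ (fun t => normc (y (t + 0) - xh (t + 0)) ^+ 2 *+ jk n 0 true t)); last first.
      by move=> t _; rewrite addr0.
    apply: le_trans h _; rewrite le_eqVlt; apply/orP; left; apply/eqP.
    by congr (_ * (_ + _)); apply: eq_symsum => t _; rewrite addr0.
  - rewrite -sum_const_blocks mulr_sumr -big_split/=; apply: ler_sum => k _.
    rewrite mulr_sumr -big_split/=; apply: ler_sum => e _.
    apply: le_trans (block k.+1 e (ltn_ord k)) _.
    rewrite (symsum_split e) -mulrDr; apply: ler_wpM2l; first exact: sqr_ge0.
    by have := hE k e (ltn_ord k); rewrite /dropped_point; lra.
  - rewrite nK -(sum_edges s n (fun t => normc (y t - xh t) ^+ 2)).
    rewrite -(sum_edges s n (fun t => normc (xi t) ^+ 2)).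
    rewrite big_seq big1; last first.
      move=> t; rewrite mem_cat => tE.
      have -> : xh t = y t.
        have [_ [_ He]] := xfull; move: (ms (leqnn _)); rewrite nK => sn.
        by move: tE => /orP[] /mapP [j]; rewrite mem_index_iota => ? ->; apply: He; lia.
      by rewrite subrr Normc.normc0 expr0n.
    by rewrite mulr_ge0 ?sqr_ge0// sumr_ge0// => t _; exact: sqr_ge0.
have yn : symsum (2 * n) (fun t => normc (y t) ^+ 2) = norm2 (2 * n) x ^+ 2 +
    2 * sigma * complex.Re (symsum (2 * n) (fun t => conjc (x t) * xi t)) +
    sigma ^+ 2 * symsum (2 * n) (fun t => normc (xi t) ^+ 2).
  rewrite norm2_sqr /symsum complex_Re_sum !mulr_sumr -!big_split/=; apply: eq_bigr => i _.
  rewrite yE !normc_sqrE; case: (x _) => ? ?; case: (xi _) => ? ? /=; ring.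
by rewrite /Tstat [in leRHS]norm2_sqr yn [norm2 _ (fun t => y t - xh t) ^+ 2]norm2_sqr; lra.
Qed.

End deterministic.
End test_statistic.

(** * Counting exceptional events and assembling both error bounds *)

Lemma pivot_bound n k e : (`|dropped_point n k e| <= (2 * n)%N%:Z)%R.
Proof.
have := block_center_bound n k.+1 e; rewrite /dropped_point /edge_point.
move: (block_center n k.+1 e) (n %/ 3 ^ k.+1)%N => h m.
by case: e; lia.
Qed.

Lemma all_blocks_event d (T : measurableType d) (R : realType) (P : probability T R)
  (xi : int -> T -> R[i]) (n s K : nat) (J : nat -> bool -> int -> bool) (L : R) :
  iid_std_cgauss P xi (2 * n) -> (0 < s)%N ->
  exists A : set T, [/\ measurable A, (P A <= ((2 * K.+1)%:R * expR (- L))%:E)%E &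
    forall w, ~ A w -> forall k e, (k <= K)%N ->
      block_good s (n %/ 3 ^ k) (J k e) (fun t => xi (t + block_center n k e) w)
        (block_bound s (n %/ 3 ^ k) L)].
Proof.
move=> xiP s0.
have [|A [mA PA HA]] := @union_events _ T R P ('I_K.+1 * bool)%type
  (fun i w => block_good s (n %/ 3 ^ i.1) (J i.1 i.2) (fun t => xi (t + block_center n i.1 i.2) w)
        (block_bound s (n %/ 3 ^ i.1) L)) (expR (- L)).
  move=> i; apply: (block_event xiP (J i.1 i.2) L s0).
  exact: block_center_bound.
exists A; split => //.
  by apply: le_trans PA _; rewrite lee_fin card_prod card_ord card_bool mulnC.
by move=> w nA k e kK; exact: (HA w nA (Ordinal (kK : (k < K.+1)%N), e)).
Qed.

(** The block events, with the central block counted for both signs, and one event for the edge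
    noise. *)
Lemma count_null k : ((2 * k.+1).+1 <= 6 * (k + 2))%N.
Proof. by lia. Qed.

(** To the block events are added 2K events for dropped points and one for the linear term. *)
Lemma count_signal k : ((2 * k.+1 + k * 2).+1 <= 6 * (k + 2))%N.
Proof. by lia. Qed.

Lemma half_ltW (R : realFieldType) (x y : R) : 2^-1 * x < y -> x <= 2 * y.
Proof. by lra. Qed.

(** Undoes the Chernoff scaling 1 / (4 sigma), chosen so that the exponential moment of the linear
    term costs exactly q / 8. *)
Lemma linear_term_lower (R : realFieldType) (sigma q L z : R) : 0 < sigma ->
  - (4 * sigma)^-1 * z < q / (64 * sigma ^+ 2) + L ->
  - (q / 8) - 8 * sigma ^+ 2 * L < 2 * sigma * z.
Proof.
move=> sig0 H; have sig8 : 0 < 8 * sigma ^+ 2 by rewrite mulr_gt0// exprn_gt0.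
move: H; rewrite -(ltr_pM2l sig8).
have -> : 8 * sigma ^+ 2 * (- (4 * sigma)^-1 * z) = - (2 * sigma * z).
  by field; rewrite gt_eqF.
have -> : 8 * sigma ^+ 2 * (q / (64 * sigma ^+ 2) + L) = q / 8 + 8 * sigma ^+ 2 * L.
  by field; rewrite gt_eqF.
lra.
Qed.

Lemma signal_margin (R : realFieldType) (q t u v D : R) :
  128 * D <= q -> - (q / 8) - u < t -> u + v < 32 * D -> 5 / 8 * (128 * D) < q + t - v.
Proof. by lra. Qed.

Theorem theorem5 (R : realType) (d : measure_display) (T : measurableType d)
  (P : probability T R) (xi : int -> T -> R[i])
  (s n : nat) (sigma delta : R) :
  (exists a : nat, s = (3 ^ a)%N) ->
  (exists b : nat, n = (3 ^ b)%N) ->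
  (9 * s <= n)%N ->
  0 < sigma ->
  0 < delta < 1 ->
  iid_std_cgauss P xi (2 * n) ->
  forall est : cseq R -> cseq R,
  (forall y : cseq R, is_xfull s n y (est y)) ->
  let y (x : cseq R) (w : T) : cseq R := fun t => x t + Complex sigma 0 * xi t w in
  let thr := (5%:R / 8%:R) * r0sq s n sigma delta in
  (forall x : cseq R, norm2 (2 * n) x = 0 ->
     exists A : set T, measurable A /\ (P A <= delta%:E)%E /\
       [set w | thr < Tstat n (y x w) (est (y x w))] `<=` A) /\
  (forall (r : R) (x : cseq R), 0 <= r -> r0sq s n sigma delta <= r ^+ 2 ->
     Xs s x -> r <= norm2 (2 * n) x ->
     exists A : set T, measurable A /\ (P A <= delta%:E)%E /\
       [set w | Tstat n (y x w) (est (y x w)) <= thr] `<=` A).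
Proof.
move=> [a sE] [b nE] sn sig0 /andP [d0 d1] xiP est estP y thr.
have s0 : (0 < s)%N by rewrite sE expn_gt0.
have [ab KE] : (a + 2 <= b)%N /\ Kof n s = (b - (a + 2))%N.
  by rewrite sE nE; apply: Kof_pow; rewrite -sE -nE.
have Kb : (Kof n s <= b)%N by rewrite KE leq_subr.
have dvdK : (3 ^ Kof n s %| n)%N.
  by move: Kb; move: (Kof n s) => k kb; rewrite nE dvdn_exp2l.
have nK : (n %/ 3 ^ Kof n s = 9 * s)%N.
  by rewrite {1}nE pow_div// KE subKn// sE expnD mulnC.
have ms k : (k <= Kof n s)%N -> (9 * s <= n %/ 3 ^ k)%N.
  by move=> kK; rewrite -nK; apply: leq_div2l; rewrite ?expn_gt0// leq_exp2l.
set K := Kof n s in KE Kb dvdK nK ms.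
(* n / (9 s) = 3^K, and the factor 9 supplies the 2. *)
have kapE : log3 (n%:R / s%:R) = K%:R + 2 :> R.
  have n3 : (0 : R) < 3 by [].
  have -> : n%:R / s%:R = 3 ^+ (K + 2) :> R.
    have s0R : s%:R != 0 :> R by rewrite pnatr_eq0 -lt0n.
    apply: (mulIf s0R); rewrite divfK// sE nE !natrX -exprD; congr (_ ^+ _).
    by rewrite KE; lia.
  rewrite /log3 lnXn// -[ln 3 *+ _]mulr_natl -mulrA mulfV ?mulr1 ?natrD//.
  by rewrite gt_eqF// ln_gt0// ltr1n.
set L : R := ln (6 * log3 (n%:R / s%:R) / delta).
have k2 : (0 : R) < K%:R + 2 by rewrite ltr_wpDl.
have expL : expR (- L) = delta / (6 * (K%:R + 2)).
  rewrite expRN /L kapE lnK ?posrE ?divr_gt0 ?mulr_gt0//.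
  by rewrite invf_div.
have L0 : 0 <= L.
  rewrite /L kapE ln_ge0// ler_pdivlMr// mul1r.
  have : (0 : R) <= K%:R by [].
  lra.
set l : R := log9e3 R s.
have l4 : 4 <= l.
  have : 0 <= ln s%:R :> R by rewrite ln_ge0// ler1n.
  by rewrite /l log9e3E//; have := @ln9_ge1 R; lra.
have l1E : ln (9 * expR 4 * s%:R) = l + 1 :> R.
  rewrite /l log9e3E// !lnM ?posrE ?mulr_gt0 ?expR_gt0 ?ltr0n//.
  by rewrite expRK; lra.
set La : R := ln (2 * n).+1%:R.
have La0 : 0 <= La by rewrite ln_ge0// ler1n.
have s1 : (1 : R) <= s%:R by rewrite ler1n.
have K0 : (0 : R) <= K%:R by [].
set c := c_star R.
set Xi : R := 6 * s%:R + 3 * s%:R * La + l * L.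
set B := 30 * l * Xi.
set D := c ^+ 2 * (Xi * (l + 1) * (K%:R + 2)).
have rE : r0sq s n sigma delta = 128 * (sigma ^+ 2 * D).
  by rewrite /r0sq -/c -/L kapE l1E -/(log9e3 R s) -/l -/La -/Xi /D; ring.
have [num1 num2] := numeric_margins (@c_star_ge14 R) l4 s1 La0 L0 K0.
rewrite -/Xi -/B -/c -/D in num1 num2.
have sig2 : 0 < sigma ^+ 2 by rewrite exprn_gt0.
have goodB J u k : block_good s (n %/ 3 ^ k) J u (block_bound s (n %/ 3 ^ k) L) ->
    block_good s (n %/ 3 ^ k) J u B.
  have h := block_bound_le s0 (leq_div n (3 ^ k)) L0.
  by move=> g S cS; have [g1 g2] := g S cS; split; [apply: le_trans g1 h|apply: le_trans g2 h].
have prob (j : nat) : (j <= 6 * (K + 2))%N -> j%:R * expR (- L) <= delta.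
  move=> jK; rewrite expL mulrA ler_pdivrMr ?mulr_gt0// mulrC ler_pM2l//.
  by rewrite -natrD -natrM ler_nat.
split=> [x x0|r x r0 rr xX rx].
  have [A [mA PA HA]] := union2_events (all_blocks_event K (jk n) L xiP s0)
    (chernoff1 L (measurable_funM (measurable_cst _) (measurable_sum_normc xiP (@edges_le s n)))
      (sum_normc_mgf xiP (uniq_edges s n) (@edges_le s n))).
  exists A; split => //; split.
    apply: le_trans PA _; rewrite lee_fin -[X in _ + X]mul1r -mulrDl natr1.
    exact: (prob (2 * K.+1).+1 (count_null K)).
  move=> w /=; apply: contraPP => /HA [good edge]; apply/negP; rewrite -leNgt.
  rewrite size_edges// natrM in edge.
  have hE : \sum_(t <- edges s n) Normc.normc (xi t w) ^+ 2 <= 2 * (18 * s%:R + L).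
    exact: half_ltW.
  apply: (@le_trans _ _ (sigma ^+ 2 * ((1 + 2 * K%:R) * (2 * (c * B)) + 2 * (18 * s%:R + L)))).
    apply: (Tstat_null s0 dvdK nK ms (estP _) (ltW sig0) _ _ hE).
      by move=> t tn; rewrite /y (norm2_eq0 x0 tn) add0r.
    by move=> k e kK; apply: goodB; exact: good.
  have -> : thr = sigma ^+ 2 * (80 * D) by rewrite /thr rE; field.
  by rewrite ler_pM2l.
pose q : R := norm2 (2 * n) x ^+ 2.
have qr : 128 * (sigma ^+ 2 * D) <= q.
  by rewrite -rE; apply: le_trans rr _; rewrite /q ler_sqr ?nnegrE// (le_trans r0).
(* The sign is negative because a lower bound on the linear term is sought. *)
pose g : R[i] := (- (4 * sigma)^-1)%:C%C.
pose lin (w : T) := symsum (2 * n) (fun t => conjc (x t) * xi t w).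
have linE w : complex.Re (symsum (2 * n) (fun t => (g * conjc (x t)) * xi t w)) =
    - (4 * sigma)^-1 * complex.Re (lin w).
  have -> : symsum (2 * n) (fun t => (g * conjc (x t)) * xi t w) = g * lin w.
    by rewrite /lin /symsum mulr_sumr; apply: eq_bigr => i _; rewrite mulrA.
  by rewrite complex_ReM /= mul0r subr0.
have lin_mgf : (\int[P]_w (expR (complex.Re (symsum (2 * n) (fun t => (g * conjc (x t)) * xi t w))))%:E
    <= (expR (q / (64 * sigma ^+ 2)))%:E)%E.
  rewrite (iid_mgf xiP) lee_fin ler_expR /q norm2_sqr /symsum !mulr_suml.
  apply: ler_sum => i _; rewrite Normc.normcM normc_conj exprMn normc_real real_normK ?num_real//.
  by rewrite le_eqVlt; apply/orP; left; apply/eqP; field; rewrite gt_eqF.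
have pivots : exists A : set T, [/\ measurable A, (P A <= (#|{: 'I_K * bool}|%:R * expR (- L))%:E)%E &
    forall w, ~ A w -> forall i : 'I_K * bool, 2^-1 * \sum_(t <- [:: dropped_point n i.1 i.2]) Normc.normc (xi t w) ^+ 2 < 1 + L].
  apply: union_events => i.
  have pK t : t \in [:: dropped_point n i.1 i.2] -> (`|t| <= (2 * n)%N%:Z)%R.
    by rewrite inE => /eqP ->; exact: pivot_bound.
  exact: (chernoff1 L (measurable_funM (measurable_cst _) (measurable_sum_normc xiP pK))
    (sum_normc_mgf xiP (isT : uniq [:: dropped_point n i.1 i.2]) pK)).
have [A [mA PA HA]] := union2_events (union2_events
  (all_blocks_event K (fun _ _ _ => true) L xiP s0) pivots)
  (chernoff1 L (measurable_Re_lin xiP _) lin_mgf).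
exists A; split => //; split.
  apply: le_trans PA _; rewrite lee_fin -[X in _ + X]mul1r -!mulrDl -natrD natr1.
  rewrite card_prod card_ord card_bool.
  exact: (prob (2 * K.+1 + K * 2).+1 (count_signal K)).
move=> w /=; apply: contraPP => /HA [[good piv] linw]; apply/negP; rewrite -ltNge.
rewrite linE in linw.
have hpiv k e : (k < K)%N -> Normc.normc (xi (dropped_point n k e) w) ^+ 2 <= 2 * (1 + L).
  by move=> kK; have := piv (Ordinal kK, e); rewrite big_seq1 => /half_ltW.
have goodw k e : (k <= K)%N -> block_good s (n %/ 3 ^ k) (fun _ => true) (fun t => xi (t + block_center n k e) w) B.
  by move=> kK; apply: goodB; exact: good.
have := @Tstat_signal R s n (y x w) (est (y x w)) (fun t => xi t w) sigma B
  s0 dvdK nK ms (estP _) (ltW sig0) x (2 * (1 + L)) xX (fun t => erefl) goodw hpiv.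
rewrite -/q -/(lin w) -/c; apply: lt_le_trans.
have hlin := linear_term_lower sig0 linw.
rewrite /thr rE; apply: (signal_margin qr hlin).
have -> : 8 * sigma ^+ 2 * L + sigma ^+ 2 * (2 * K%:R * (2 * (1 + L)) + (1 + 2 * K%:R) * (3 * (c * B))) =
  sigma ^+ 2 * (8 * L + 2 * K%:R * (2 * (1 + L)) + (1 + 2 * K%:R) * (3 * (c * B))) by ring.
have -> : 32 * (sigma ^+ 2 * D) = sigma ^+ 2 * (32 * D) by ring.
by rewrite ltr_pM2l.
Qed.
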